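(* Let $p$ be a prime, $s\ge 1$, and $n=mp^a$ with $m\ge1$, $p\nmid m$, $a\geq 0$. Let $C$ be a cyclic code of length $n$ over ${\rm GR}(p^2,s)$ which, under the Discrete Fourier Transform ring isomorphism ${\rm GR}(p^2,s)[X]/\langle X^{mp^a}-1\rangle\cong\prod_{h\in J_0\cup J_1\cup J_2}R_{p^2}(u,sm_h)$, $c(X)\mapsto(\widehat{c}_h)_{h}$, corresponds to \[C\cong \prod_{j\in J_0} C_j \times \prod_{h \in J_1 } C_h \times \prod_{k\in J_2} C_k,\] where each $C_h$ is an ideal of $R_{p^2}(u,sm_h)$. Then, under the same isomorphism, \[C^{\perp_{\rm E}}\cong \prod_{j\in J_0} C_j^{\perp_{\rm E}} \times \prod_{h \in J_1 } C_h^{\perp_{\rm H}} \times \prod_{k\in J_2} C^{\perp_{\rm E}}_{m-k\,({\rm mod}\,m)}.\] Moreover, $C$ is Euclidean self-dual if and only if $C_j$ is Euclidean self-dual for all $j\in J_0$, $C_h$ is Hermitian self-dual for all $h\in J_1$, and $C_k = C^{\perp_{\rm E}}_{m-k\,({\rm mod}\,m)}$ for all $k\in J_2$.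
   Context: ${\rm GR}(p^2,r)$ is the Galois extension of $\mathbb{Z}_{p^2}$ of degree $r$, with Teichmüller set $\mathcal{T}_r=\{0,1,\xi,\dots,\xi^{p^r-2}\}$ ($\xi$ of multiplicative order $p^r-1$); every element is uniquely $a_0+b_0p$ with $a_0,b_0\in\mathcal{T}_r$. For $r$ even, $\overline{a_0+b_0p}=a_0^{p^{r/2}}+b_0^{p^{r/2}}p$ is a ring automorphism. A cyclic code of length $n$ over ${\rm GR}(p^2,r)$ is a submodule of ${\rm GR}(p^2,r)^n$ invariant under the cyclic shift, identified with an ideal of ${\rm GR}(p^2,r)[X]/\langle X^n-1\rangle$. $C^{\perp_{\rm E}}$ is the dual with respect to $\langle \boldsymbol{u},\boldsymbol{v}\rangle_{\rm E}=\sum_i u_iv_i$ and, for $r$ even, $C^{\perp_{\rm H}}$ is the dual with respect to $\langle \boldsymbol{u},\boldsymbol{v}\rangle_{\rm H}=\sum_i u_i\overline{v_i}$. $C$ is Euclidean (resp. Hermitian) self-dual if $C=C^{\perp_{\rm E}}$ (resp. $C=C^{\perp_{\rm H}}$). $R_{p^2}(u,r):={\rm GR}(p^2,r)[u]/\langle u^{p^a}-1\rangle$; its ideals are regarded as cyclic codes of length $p^a$ over ${\rm GR}(p^2,r)$ (coefficients with respect to $1,u,\dots,u^{p^a-1}$), and their Euclidean/Hermitian duals are taken in this sense. For $0\le h\le m-1$, $S_{p^s}(h)=\{hp^{is}\bmod m\mid i\ge0\}$ is the $p^s$-cyclotomic coset of $h$ modulo $m$ and $m_h=|S_{p^s}(h)|$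 (note $m_h=m_{-h}$). It is self-inverse if $S_{p^s}(-h)=S_{p^s}(h)$ (elements taken modulo $m$). $I_0=\{0\}$ if $m$ is odd, $I_0=\{0,m/2\}$ if $m$ is even; $I_1$ is the union of all self-inverse cosets not contained in $I_0$ (for $h\in I_1$, $m_h$ is even); $I_2=\{0,\dots,m-1\}\setminus(I_0\cup I_1)$. $J_0,J_1,J_2$ are complete sets of representatives of the $p^s$-cyclotomic cosets in $I_0,I_1,I_2$, with $J_2$ chosen so that $h\in J_2$ iff $-h\in J_2$ (modulo $m$). Discrete Fourier Transform: let $M$ be the multiplicative order of $p^s$ modulo $m$, $\zeta$ a primitive $m$th root of unity in ${\rm GR}(p^2,sM)$, and $m'$ an integer with $mm'\equiv1\pmod{p^a}$. For $c(X)=\sum_{i=0}^{m-1}\sum_{j=0}^{p^a-1}c_{i,j}X^{i+jm}$, put $\widehat{c}_h=\sum_{i=0}^{m-1}\sum_{j=0}^{p^a-1}c_{i,j}u^{m'i+j}\zeta^{hi}$, which lies in $R_{p^2}(u,sm_h)\subseteq R_{p^2}(u,sM)$. The map $c(X)\mapsto(\widehat{c}_h)_{h\in J_0\cup J_1\cup J_2}$ is a ring isomorphism ${\rm GR}(p^2,s)[X]/\langle X^{mp^a}-1\rangle\to\prod_{h\in J_0\cup J_1\cup J_2}R_{p^2}(u,sm_h)$, so every cyclic code (ideal) corresponds to a product of ideals. *)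

(* Defs.v *)
From mathcomp Require Import all_boot all_order all_algebra.

Set Implicit Arguments.
Unset Strict Implicit.
Unset Printing Implicit Defensive.

Import GRing.Theory.
Local Open Scope ring_scope.

(* All the Galois rings GR(p^2, r) are taken as subrings of one
   ambient finite ring G, so that the inclusions
   R_{p^2}(u, r) <= R_{p^2}(u, s * M) are inclusions of sets. *)

Definition basic_irreducible (p r : nat) (f : {poly 'Z_(p ^ 2)}) : Prop :=
  [/\ f \is monic, size f = r.+1
    & irreducible_poly (map_poly (fun x : 'Z_(p ^ 2) => (x : nat)%:R : 'F_p) f)].

(* S is a subring of G isomorphic to GR(p^2, r) = Z_{p^2}[X] / (f). *)
Definition is_GR (p r : nat) (G : finComNzRingType) (S : {set G}) : Prop :=
  exists f : {poly 'Z_(p ^ 2)}, basic_irreducible r f /\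
  exists phi : {rmorphism {poly %/ f} -> G},
    injective phi /\ forall x : G, x \in S <-> exists y, phi y = x.

(* G is GR(p^2, R), and GR r is its copy of GR(p^2, r) for every r %| R
   (the copy is unique as a subset of G). *)
Definition GR_tower (p R : nat) (G : finComNzRingType) (GR : nat -> {set G}) :
    Prop :=
  GR R = [set: G] /\ forall r, (r %| R)%N -> is_GR p r (GR r).

(* {0, 1, xi, ..., xi ^ (p ^ r - 2)} with xi in S of order p ^ r - 1;
   the set does not depend on the choice of xi. *)
Definition teichmuller (p r : nat) (G : finComNzRingType) (S : {set G}) :
    {set G} :=
  if [pick xi in S | (p ^ r).-1.-primitive_root xi] is Some xi
  then 0 |: [set xi ^+ i | i : 'I_(p ^ r).-1] else set0.

(* The junk value x is never returned when S = GR(p^2, r) and x \in S. *)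
Definition GR_conj (p r : nat) (G : finComNzRingType) (S : {set G}) (x : G) :
    G :=
  let T := teichmuller p r S in
  if [pick ab : G * G |
        [&& ab.1 \in T, ab.2 \in T & x == ab.1 + ab.2 *+ p]] is Some (a0, b0)
  then a0 ^+ (p ^ r./2) + b0 ^+ (p ^ r./2) *+ p else x.

Definition words (G : finComNzRingType) (n : nat) (S : {set G}) :
    {set 'rV[G]_n} :=
  [set v : 'rV[G]_n | [forall i, v 0 i \in S]].

Definition cshift (G : finComNzRingType) (n : nat) (v : 'rV[G]_n) : 'rV[G]_n :=
  \row_i v 0 (ord_pred i).

Definition cyclic_code (G : finComNzRingType) (n : nat) (S : {set G})
    (C : {set 'rV[G]_n}) : Prop :=
  [/\ C \subset words n S, 0 \in C,
      {in C &, forall v w, v + w \in C},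
      {in S & C, forall a v, a *: v \in C}
    & {in C, forall v, cshift v \in C}].

Definition dotE (G : finComNzRingType) (n : nat) (v w : 'rV[G]_n) : G :=
  \sum_i v 0 i * w 0 i.

Definition dotH (p r : nat) (G : finComNzRingType) (n : nat) (S : {set G})
    (v w : 'rV[G]_n) : G :=
  \sum_i v 0 i * GR_conj p r S (w 0 i).

Definition dualE (G : finComNzRingType) (n : nat) (S : {set G})
    (C : {set 'rV[G]_n}) : {set 'rV[G]_n} :=
  [set w in words n S | [forall v in C, dotE v w == 0]].

Definition dualH (p r : nat) (G : finComNzRingType) (n : nat) (S : {set G})
    (C : {set 'rV[G]_n}) : {set 'rV[G]_n} :=
  [set w in words n S | [forall v in C, dotH p r S v w == 0]].

(* G[u] / (u ^ (p ^ a) - 1), with u = 'qX; the coefficients of an element x are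
   those of its representative x : {poly G} of degree < p ^ a. *)
Notation Ru G p a := {poly %/ ('X^(p ^ a) - 1 : {poly G})} (only parsing).

Definition coefs (p a : nat) (G : finComNzRingType) (x : Ru G p a) :
    'rV[G]_(p ^ a) :=
  poly_rV x.

Definition Ru_sub (p a : nat) (G : finComNzRingType) (S : {set G}) :
    {set Ru G p a} :=
  [set x : Ru G p a | coefs x \in words _ S].

Definition Ru_ideal (p a : nat) (G : finComNzRingType) (S : {set G})
    (I : {set Ru G p a}) : Prop :=
  [/\ I \subset Ru_sub p a S, 0 \in I,
      {in I &, forall x y, x + y \in I}
    & {in Ru_sub p a S & I, forall x y, x * y \in I}].

Definition code_of (p a : nat) (G : finComNzRingType) (I : {set Ru G p a}) :
    {set 'rV[G]_(p ^ a)} :=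
  [set coefs x | x in I].

Definition Ru_dualE (p a : nat) (G : finComNzRingType) (S : {set G})
    (I : {set Ru G p a}) : {set Ru G p a} :=
  [set x : Ru G p a | coefs x \in dualE S (code_of I)].

Definition Ru_dualH (p a r : nat) (G : finComNzRingType) (S : {set G})
    (I : {set Ru G p a}) : {set Ru G p a} :=
  [set x : Ru G p a | coefs x \in dualH p r S (code_of I)].

Lemma ord_mod_subproof (m : nat) (h : 'I_m) (k : nat) : (k %% m < m)%N.
Proof. by rewrite ltn_pmod // (leq_ltn_trans (leq0n h) (ltn_ord h)). Qed.

Definition ord_scale (m q : nat) (h : 'I_m) : 'I_m :=
  Ordinal (ord_mod_subproof h (h * q)%N).

Definition ord_opp (m : nat) (h : 'I_m) : 'I_m :=
  Ordinal (ord_mod_subproof h (m - h)%N).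

Definition cyc_coset (m q : nat) (h : 'I_m) : {set 'I_m} :=
  [set x | fconnect (ord_scale q) h x].

Lemma cyc_cosetP (m q : nat) (h x : 'I_m) :
  reflect (exists i, x = (h * q ^ i) %% m :> nat)%N (x \in cyc_coset q h).
Proof.
have iterE i : iter i (ord_scale q) h = ((h * q ^ i) %% m)%N :> nat.
  elim: i => [|i IHi] /=; first by rewrite expn0 muln1 modn_small.
  by rewrite IHi modnMml expnSr mulnA.
rewrite inE; apply: (iffP idP) => [hx | [i xE]].
  by exists (findex (ord_scale q) h x); rewrite -iterE iter_findex.
have -> : x = iter i (ord_scale q) h by apply: val_inj; rewrite /= iterE.
exact: fconnect_iter.
Qed.

Definition self_inverse (m q : nat) (h : 'I_m) : bool :=
  cyc_coset q (ord_opp h) == cyc_coset q h.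

Definition I0 (m : nat) : {set 'I_m} :=
  [set h : 'I_m | (h == 0 :> nat) || (~~ odd m && (h == m./2 :> nat))].

Definition I1 (m q : nat) : {set 'I_m} :=
  \bigcup_(h | self_inverse q h && ~~ (cyc_coset q h \subset I0 m)) cyc_coset q h.

Definition I2 (m q : nat) : {set 'I_m} := ~: (I0 m :|: I1 m q).

Definition coset_reps (m q : nat) (J I : {set 'I_m}) : Prop :=
  is_transversal J [set cyc_coset q h | h in I] I.

(* Meaningful for m = 1 too, where M = 1. *)
Definition is_mult_order (m q M : nat) : Prop :=
  [/\ (0 < M)%N, (q ^ M = 1 %[mod m])%N
    & forall k, (0 < k)%N -> (q ^ k = 1 %[mod m])%N -> (M <= k)%N].

(* u ^ k for an integer k: u ^ (p ^ a) = 1, so k only matters modulo p ^ a. *)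
Definition upow (p a : nat) (G : finComNzRingType) (k : int) : Ru G p a :=
  'qX ^+ `|(k %% (p ^ a)%:Z)%Z|%N.

Definition dft (p a m : nat) (G : finComNzRingType) (m' : int) (zeta : G)
    (c : 'rV[G]_(m * p ^ a)) (h : nat) : Ru G p a :=
  \sum_(i < m) \sum_(j < p ^ a)
    ((rVpoly c)`_(i + j * m)%N * zeta ^+ (h * i)) *: upow p a G (m' * i%:Z + j%:Z).

Definition dft_on (p a m : nat) (G : finComNzRingType) (m' : int) (zeta : G)
    (J : {set 'I_m}) (c : 'rV[G]_(m * p ^ a)) :
    {ffun {h : 'I_m | h \in J} -> Ru G p a} :=
  [ffun h : {h : 'I_m | h \in J} => dft m' zeta c (val h)].

(* The image of C under the transform is the product of the D h, h in J. *)
Definition corresponds (p a m : nat) (G : finComNzRingType) (m' : int)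
    (zeta : G) (J : {set 'I_m}) (C : {set 'rV[G]_(m * p ^ a)})
    (D : 'I_m -> {set Ru G p a}) : Prop :=
  [set dft_on m' zeta J c | c in C] =
  [set y : {ffun {h : 'I_m | h \in J} -> Ru G p a} |
     [forall h : {h : 'I_m | h \in J}, y h \in D (val h)]].

(* Main.v *)
Require Import Defs.
From HB Require Import structures.
From mathcomp Require Import all_boot all_order all_fingroup all_algebra.
From mathcomp Require Import all_solvable all_field.
From mathcomp Require Import zify.

(* Evaluating c(X) at X = zeta^h u^m' gives the component of c at h, and a
   direct expansion yields
     <c^_h, d^_(-h)> = sum_(t, t') c_t d_t' zeta^(h(t - t')) [t = t' mod p^a].
   The kernel only depends on t - t', so this is a combination of the products
   <shift^l c, d>, which vanish when d is orthogonal to a cyclic code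
   containing c; and summing over all h mod m gives m <c, d>, whence both the
   converse and the injectivity of the transform.  Its surjectivity onto the
   product of the R(u, s m_h) then follows by counting.  So the component of the
   dual at -h is the orthogonal of C_h.  For h in I1 one has -h = h q^(m_h/2),
   with q = p^s, and passing from h to h q applies the s-th power of the
   Frobenius automorphism to coefficients; this turns the orthogonality at -h
   into Hermitian orthogonality at h. *)

Set Implicit Arguments.
Unset Strict Implicit.
Unset Printing Implicit Defensive.

Import GRing.Theory.

(** * Cyclotomic cosets *)

Section CyclotomicCosets.

Variables (m q M : nat).
Hypothesis M_order : is_mult_order m q M.
Implicit Types h x : 'I_m.
Local Notation f := (@ord_scale m q).

Lemma ord_scaleE h : f h = (h * q) %% m :> nat.
Proof. by []. Qed.

Lemma iter_ord_scale h i : iter i f h = (h * q ^ i) %% m :> nat.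
Proof.
elim: i => [|i IHi] /=; first by rewrite expn0 muln1 modn_small.
by rewrite IHi modnMml expnSr mulnA.
Qed.

Lemma iter_mult_order h : iter M f h = h.
Proof.
have [_ qM _] := M_order.
apply: val_inj; rewrite /= iter_ord_scale -modnMmr qM modnMmr muln1.
exact: modn_small.
Qed.

(** Its M-th iterate is the identity. Reachability under [f] is therefore symmetric, and the cosets
    are the cycles of a permutation. *)
Lemma ord_scale_inj : injective f.
Proof.
have [M_gt0 _ _] := M_order.
move=> x y xy; rewrite -(iter_mult_order x) -(iter_mult_order y).
by rewrite -(prednK M_gt0) !iterSr xy.
Qed.

Lemma mem_cyc_coset h x : (x \in cyc_coset q h) = fconnect f h x.
Proof. by rewrite inE. Qed.

Lemma cyc_coset_sym h x : (x \in cyc_coset q h) = (h \in cyc_coset q x).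
Proof. by rewrite !mem_cyc_coset (fconnect_sym ord_scale_inj). Qed.

Lemma cyc_coset_id h : h \in cyc_coset q h.
Proof. by rewrite mem_cyc_coset connect0. Qed.

Lemma cyc_coset_eq h x : x \in cyc_coset q h -> cyc_coset q x = cyc_coset q h.
Proof.
rewrite mem_cyc_coset => hx; apply/setP=> y.
by rewrite !mem_cyc_coset -(same_connect (fconnect_sym ord_scale_inj) hx).
Qed.

Lemma card_cyc_coset h : #|cyc_coset q h| = fingraph.order f h.
Proof. by apply: eq_card => x; rewrite mem_cyc_coset. Qed.

Lemma iter_card_cyc_coset h : iter #|cyc_coset q h| f h = h.
Proof. by rewrite card_cyc_coset (iter_order ord_scale_inj). Qed.

(** Reduce k modulo the cycle length: the remainder is the index at which [h] is reached from
    itself, which is 0. *)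
Lemma card_cyc_coset_dvd h k : iter k f h = h -> (#|cyc_coset q h| %| k)%N.
Proof.
rewrite card_cyc_coset => hk; have o_gt0 := fingraph.order_gt0 f h.
have iterMo i : iter (i * fingraph.order f h) f h = h.
  by elim: i => // i IHi; rewrite mulSn iterD IHi (iter_order ord_scale_inj).
have : iter (k %% fingraph.order f h) f h = h.
  by move: hk; rewrite {1}(divn_eq k (fingraph.order f h)) addnC iterD iterMo.
move/(congr1 (findex f h)); rewrite findex_iter ?ltn_mod // findex0.
by move/eqP.
Qed.

Lemma ord_oppE h : (ord_opp h + h = 0 %[mod m])%N.
Proof. by rewrite /= modnDml subnK ?modnn ?mod0n // ltnW. Qed.

Lemma ord_opp_uniq h x : (x + h = 0 %[mod m])%N -> x = ord_opp h.
Proof.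
rewrite -(ord_oppE h) => /eqP; rewrite eqn_modDr => /eqP.
by rewrite !modn_small // => /val_inj.
Qed.

Lemma ord_oppK : involutive (@ord_opp m).
Proof. by move=> h; apply/esym/ord_opp_uniq; rewrite addnC ord_oppE. Qed.

Lemma ord_opp_scale h : ord_opp (f h) = f (ord_opp h).
Proof.
apply/esym/ord_opp_uniq.
rewrite !ord_scaleE modnDm -mulnDl.
by rewrite -modnMml ord_oppE mod0n mul0n mod0n.
Qed.

Lemma ord_opp_iter i h : ord_opp (iter i f h) = iter i f (ord_opp h).
Proof. by elim: i => //= i IHi; rewrite ord_opp_scale IHi. Qed.

Lemma card_cyc_coset_opp h : #|cyc_coset q (ord_opp h)| = #|cyc_coset q h|.
Proof.
apply/eqP; rewrite eqn_dvd; apply/andP; split; apply: card_cyc_coset_dvd.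
  by rewrite -ord_opp_iter iter_card_cyc_coset.
by apply: (inv_inj ord_oppK); rewrite ord_opp_iter iter_card_cyc_coset.
Qed.

(** The solutions of 2h = 0 modulo m are 0 and, for even m, m/2. In this form, stability of [I0]
    under scaling is immediate. *)
Lemma mem_I0 h : (h \in I0 m) = (ord_opp h == h).
Proof.
have hm := ltn_ord h; rewrite inE -val_eqE /=.
have [h0|h_gt0] := posnP h; first by rewrite h0 subn0 modnn.
by rewrite modn_small; lia.
Qed.

Lemma cyc_coset_I0 h x : x \in cyc_coset q h -> (x \in I0 m) = (h \in I0 m).
Proof.
suff sub y z : z \in cyc_coset q y -> y \in I0 m -> z \in I0 m.
  by move=> xh; apply/idP/idP; apply: sub; rewrite // cyc_coset_sym.
rewrite mem_cyc_coset !mem_I0 => /iter_findex <- /eqP yE.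
by rewrite ord_opp_iter yE.
Qed.

(** A coset lies inside [I0] as soon as it meets it, so both conditions defining [I1] can be tested
    on a single element. *)
Lemma mem_I1 h :
  (h \in I1 m q) = (ord_opp h \in cyc_coset q h) && (h \notin I0 m).
Proof.
apply/bigcupP/andP=> [[h' /andP[/eqP sh' /subsetPn[x xh' xI0]] hh']|[oh hI0]].
  rewrite (cyc_coset_I0 hh') -(cyc_coset_I0 xh') xI0 (cyc_coset_eq hh') -sh'.
  move: hh'; rewrite (mem_cyc_coset h' h) => /iter_findex <-.
  by rewrite ord_opp_iter mem_cyc_coset fconnect_iter.
exists h; last exact: cyc_coset_id.
rewrite /Defs.self_inverse (cyc_coset_eq oh) eqxx.
by apply/subsetPn; exists h; rewrite ?cyc_coset_id.
Qed.

Lemma cyc_coset_I1 h x : x \in cyc_coset q h -> (x \in I1 m q) = (h \in I1 m q).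
Proof.
suff sub y z : z \in cyc_coset q y -> y \in I1 m q -> z \in I1 m q.
  by move=> xh; apply/idP/idP; apply: sub; rewrite // cyc_coset_sym.
move=> zy /bigcupP[h' h'P yh']; apply/bigcupP; exists h' => //.
by rewrite -(cyc_coset_eq yh').
Qed.

(** If k steps lead from h to -h, then 2k steps lead back to h, so m_h divides 2k; since 0 < k <
    m_h, this forces 2k = m_h. *)
Lemma half_cyc_coset_I1 h : h \in I1 m q ->
  exists2 k, #|cyc_coset q h| = k.*2 & iter k f h = ord_opp h.
Proof.
rewrite mem_I1 mem_I0 => /andP[]; rewrite mem_cyc_coset => oh h_opp.
exists (findex f h (ord_opp h)); last exact: iter_findex.
set k := findex _ _ _.
have kh : iter k f h = ord_opp h by exact: iter_findex.
have k_lt : (k < #|cyc_coset q h|)%N by rewrite card_cyc_coset findex_max.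
have : (#|cyc_coset q h| %| k + k)%N.
  by apply: card_cyc_coset_dvd; rewrite iterD kh -ord_opp_iter kh ord_oppK.
(* Quotient 0 would give k = 0 and -h = h, which [h_opp] excludes; a quotient of at least 2
   contradicts k < m_h. *)
case/dvdnP=> -[|[|j]] kE; last by lia.
  by case/eqP: h_opp; rewrite -kh; have -> : k = 0%N by lia.
by lia.
Qed.

(** * Representatives of the cosets *)

Section Representatives.

Lemma coset_repsP (J I : {set 'I_m}) : coset_reps q J I ->
  [/\ J \subset I,
      forall x, x \in I -> exists2 j, j \in J & j \in cyc_coset q x
    & {in J &, forall j j', j \in cyc_coset q j' -> j = j'}].
Proof.
case/and3P=> _ sJI /forall_inP J1; split=> // [x xI|j j' jJ j'J jj'].
  have /J1/cards1P[j JE] : cyc_coset q x \in [set cyc_coset q h | h in I].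
    exact: imset_f.
  have : j \in [set j] by rewrite inE.
  by rewrite -JE inE => /andP[jJ jx]; exists j.
have /J1/cards1P[k JE] : cyc_coset q j' \in [set cyc_coset q h | h in I].
  by apply: imset_f; apply: (subsetP sJI).
have jk : j \in [set k] by rewrite -JE inE jJ.
have j'k : j' \in [set k] by rewrite -JE inE j'J cyc_coset_id.
by move: jk j'k; rewrite !inE => /eqP-> /eqP->.
Qed.

Variables J0 J1 J2 : {set 'I_m}.
Hypotheses (J0_reps : coset_reps q J0 (I0 m))
  (J1_reps : coset_reps q J1 (I1 m q)) (J2_reps : coset_reps q J2 (I2 m q)).
Local Notation J := (J0 :|: J1 :|: J2).

Lemma reps_cover x : exists2 j, j \in J & exists i, x = iter i f j.
Proof.
suff [j jJ jx] : exists2 j, j \in J & j \in cyc_coset q x.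
  exists j => //; exists (findex f j x); rewrite iter_findex //.
  by rewrite -mem_cyc_coset cyc_coset_sym.
have [_ cov0 _] := coset_repsP J0_reps; have [_ cov1 _] := coset_repsP J1_reps.
have [_ cov2 _] := coset_repsP J2_reps.
have [/cov0[j jJ jx]|x0] := boolP (x \in I0 m).
  by exists j; rewrite // !inE jJ.
have [/cov1[j jJ jx]|x1] := boolP (x \in I1 m q).
  by exists j; rewrite // !inE jJ orbT.
have [|j jJ jx] := cov2 x; first by rewrite in_setC in_setU negb_or x0.
by exists j; rewrite // !inE jJ orbT.
Qed.

Lemma reps_J0 j : j \in J0 -> ord_opp j = j.
Proof.
have [/subsetP sJ _ _] := coset_repsP J0_reps.
by move/sJ; rewrite mem_I0 => /eqP.
Qed.

Lemma reps_J1 j : j \in J1 -> (j \in I1 m q) && (j \notin J0).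
Proof.
have [/subsetP sJ1 _ _] := coset_repsP J1_reps.
have [/subsetP sJ0 _ _] := coset_repsP J0_reps.
move=> /sJ1 jI1; rewrite jI1; apply: contraL jI1 => /sJ0 jI0.
by rewrite mem_I1 jI0 andbF.
Qed.

Lemma reps_J2 j : j \in J2 -> (j \notin J0) && (j \notin J1).
Proof.
have [/subsetP sJ2 _ _] := coset_repsP J2_reps.
have [/subsetP sJ1 _ _] := coset_repsP J1_reps.
have [/subsetP sJ0 _ _] := coset_repsP J0_reps.
move=> /sJ2; rewrite in_setC in_setU negb_or => /andP[j0 j1].
by rewrite (contra (@sJ0 j) j0) (contra (@sJ1 j) j1).
Qed.

(** [I0], [I1] and [I2] are disjoint unions of cosets, so two representatives of one coset come from
    the same transversal. *)
Lemma reps_inj : {in J &, forall j j', j \in cyc_coset q j' -> j = j'}.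
Proof.
have [/subsetP sJ0 _ inj0] := coset_repsP J0_reps.
have [/subsetP sJ1 _ inj1] := coset_repsP J1_reps.
have [/subsetP sJ2 _ inj2] := coset_repsP J2_reps.
have cls j : j \in J ->
    [\/ (j \in J0) && (j \in I0 m),
        [&& j \in J1, j \in I1 m q & j \notin I0 m]
      | [&& j \in J2, j \notin I0 m & j \notin I1 m q]].
  case/setUP=> [/setUP[] jJ|jJ].
  - by constructor 1; rewrite jJ sJ0.
  - by constructor 2; have := sJ1 _ jJ; rewrite jJ mem_I1 => /andP[-> ->].
  - by constructor 3; have := sJ2 _ jJ; rewrite jJ in_setC in_setU negb_or.
move=> j j' /cls jJ /cls j'J jj'; move: jJ.
rewrite (cyc_coset_I0 jj') (cyc_coset_I1 jj').
case: j'J => [/andP[j'J ->]|/and3P[j'J -> /negPf->]|].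
3: case/and3P=> j'J /negPf-> /negPf->.
- by case=> [/andP[jJ _]|/and3P[]//|/and3P[]//]; exact: inj0.
- by case=> [/andP[]//|/and3P[jJ _ _]|/and3P[]//]; exact: inj1.
- by case=> [/andP[]//|/and3P[]//|/and3P[jJ _ _]]; exact: inj2.
Qed.

(** Double counting: each x lies in the coset of at most one representative. This bounds the size of
    the product of the component rings. *)
Lemma sum_card_reps : (\sum_(j in J) #|cyc_coset q j| <= m)%N.
Proof.
under eq_bigr do rewrite -sum1_card.
rewrite (exchange_big_dep xpredT) //= -[leqRHS]card_ord -[leqRHS]sum1_card.
apply: leq_sum => x _; rewrite sum1_card; apply/card_le1P => j.
move=> /andP[jJ jx] j'; rewrite [RHS]inE.
apply/andP/eqP=> [[j'J j'x]|-> //].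
by apply: reps_inj => //; rewrite -(cyc_coset_eq jx) cyc_coset_sym.
Qed.

End Representatives.

End CyclotomicCosets.

Local Open Scope ring_scope.

(** * The residue field of a Galois ring *)

Section ReductionModP.

Variable p : nat.
Hypothesis p_prime : prime p.

Let p_gt0 : (0 < p)%N. Proof. exact: prime_gt0. Qed.
Let p2_gt1 : (1 < p ^ 2)%N.
Proof. by rewrite -(exp1n 2) ltn_exp2r ?prime_gt1. Qed.

(* The proof argument lets the morphism structures below, which depend on the
   primality of p, be inferred from the function itself. *)
Definition redp of prime p := fun x : 'Z_(p ^ 2) => (x : nat)%:R : 'F_p.
Local Notation red := (redp p_prime).

Lemma natr_Zp2_eq (j k : nat) :
  (j%:R == k%:R :> 'Z_(p ^ 2)) = (j == k %[mod p ^ 2])%N.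
Proof. by rewrite -val_eqE /= !val_Zp_nat. Qed.

Lemma natr_Fp_eq (j k : nat) : (j%:R == k%:R :> 'F_p) = (j == k %[mod p])%N.
Proof. by rewrite -val_eqE /= !val_Fp_nat. Qed.

Lemma redp_nat (k : nat) : red k%:R = k%:R.
Proof.
apply/eqP; rewrite /redp natr_Fp_eq val_Zp_nat // modn_dvdm //.
exact: dvdn_exp.
Qed.

Fact redp_is_zmod_morphism : zmod_morphism red.
Proof.
move=> x y; apply/eqP; rewrite eq_sym subr_eq; apply/eqP.
rewrite -[x in LHS](subrK y) -[x - y]natr_Zp -[y]natr_Zp.
by rewrite -natrD !redp_nat -natrD.
Qed.

Fact redp_is_monoid_morphism : monoid_morphism red.
Proof.
split=> [|x y]; first exact: (redp_nat 1).
rewrite -[x]natr_Zp -[y]natr_Zp -natrM !redp_nat.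
by rewrite natrM.
Qed.

HB.instance Definition _ :=
  GRing.isZmodMorphism.Build 'Z_(p ^ 2) 'F_p red redp_is_zmod_morphism.
HB.instance Definition _ :=
  GRing.isMonoidMorphism.Build 'Z_(p ^ 2) 'F_p red redp_is_monoid_morphism.

Lemma redp_eq0 (x : 'Z_(p ^ 2)) : red x = 0 -> ((x : nat) %/ p)%:R *+ p = x.
Proof.
move/eqP; rewrite /redp -[0]/(0%:R) natr_Fp_eq mod0n => px.
by rewrite -mulrnA divnK // natr_Zp.
Qed.

Lemma Zp2_mulpn_eq0 (x : 'Z_(p ^ 2)) : x *+ p = 0 -> red x = 0.
Proof.
rewrite -[x]natr_Zp redp_nat; set k := nat_of_ord x => /eqP.
rewrite -mulrnA -[0]/(0%:R) natr_Zp2_eq mod0n -[_ == _]/(_ %| _)%N.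
rewrite -mulnn dvdn_pmul2r // => pk.
by apply/eqP; rewrite -[0]/(0%:R) natr_Fp_eq mod0n.
Qed.

Lemma Zp2_mulpnp (x : 'Z_(p ^ 2)) : x *+ p *+ p = 0.
Proof.
rewrite -[x]natr_Zp; set k := nat_of_ord x.
by apply/eqP; rewrite -!mulrnA mulnn -[0]/(0%:R) natr_Zp2_eq mod0n modnMl.
Qed.

End ReductionModP.

Section GaloisRing.

Variables (p r : nat) (f : {poly 'Z_(p ^ 2)}).
Hypotheses (p_prime : prime p) (f_irr : basic_irreducible r f).

Let f_monic : f \is monic. Proof. by case: f_irr. Qed.
Let fbar := map_poly (redp p_prime) f.

Lemma fbar_irr : monic_irreducible_poly fbar.
Proof. by split; [case: f_irr | exact: monic_map]. Qed.

Definition residue_field := {poly %/ fbar with fbar_irr}.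

Definition residue (x : {poly %/ f}) : residue_field :=
  in_qpoly fbar (map_poly (redp p_prime) x).

Local Notation red := (redp p_prime).

Lemma size_gt1_of_basic_irreducible : (1 < size f)%N.
Proof.
have [[+ _] _] := fbar_irr.
by rewrite size_map_poly_id0 // (eqP f_monic) rmorph1 oner_eq0.
Qed.

Lemma mk_monic_basic_irreducible : mk_monic f = f.
Proof. by rewrite /mk_monic size_gt1_of_basic_irreducible f_monic. Qed.

(** The reduction of f vanishes in the residue field, so a prior division by f is invisible there.
    Multiplicativity of [residue] follows. *)
Lemma in_qpoly_map_mod (q : {poly 'Z_(p ^ 2)}) :
  in_qpoly fbar (map_poly red (Pdiv.Ring.rmodp q (mk_monic f))) =
  in_qpoly fbar (map_poly red q).
Proof.
rewrite [q in RHS](Pdiv.RingMonic.rdivp_eq (monic_mk_monic f)).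
rewrite rmorphD rmorphM /= in_qpolyD in_qpolyM.
rewrite mk_monic_basic_irreducible -/fbar.
suff -> : in_qpoly fbar fbar = 0 by rewrite mulr0 add0r.
apply: val_inj; rewrite /= (mk_monicE fbar_irr).
exact: (Pdiv.RingMonic.rmodpp (snd fbar_irr)).
Qed.

Fact residue_is_zmod_morphism : zmod_morphism residue.
Proof. by move=> x y; rewrite /residue /= rmorphB /= linearB. Qed.

Fact residue_is_monoid_morphism : monoid_morphism residue.
Proof.
split=> [|x y]; first by rewrite /residue /= rmorph1 in_qpoly1.
by rewrite /residue -in_qpolyM -rmorphM -[RHS]in_qpoly_map_mod.
Qed.

HB.instance Definition _ :=
  GRing.isZmodMorphism.Build {poly %/ f} residue_field residue
    residue_is_zmod_morphism.
HB.instance Definition _ :=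
  GRing.isMonoidMorphism.Build {poly %/ f} residue_field residue
    residue_is_monoid_morphism.

Lemma card_residue_field : #|residue_field| = (p ^ r)%N.
Proof.
rewrite card_qfpoly card_Fp // size_map_poly_id0; last first.
  by rewrite (eqP f_monic) rmorph1 oner_eq0.
by case: f_irr => _ ->.
Qed.

Lemma card_GR : #|{poly %/ f}| = (p ^ (2 * r))%N.
Proof.
rewrite card_monic_qpoly ?size_gt1_of_basic_irreducible // card_ord.
rewrite Zp_cast; last first.
  by rewrite -(exp1n 2) ltn_exp2r ?prime_gt1.
by rewrite expnM; case: f_irr => _ ->.
Qed.

Lemma coef_red_mulpn (x : {poly %/ f}) :
  (forall i, red x`_i = 0) -> exists y, x = y *+ p.
Proof.
move=> x0.
exists (mk_npoly _ (fun i => (nat_of_ord (x : {poly _})`_i %/ p)%:R)).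
apply: val_inj; rewrite raddfMn /=; apply/polyP=> i.
rewrite coefMn coef_poly; case: ifP => [_|/negbT]; first by rewrite redp_eq0.
by rewrite -leqNgt => /big_coef_npoly ->; rewrite mul0rn.
Qed.

Lemma residue_eq0 x : residue x = 0 -> exists y, x = y *+ p.
Proof.
move=> /(congr1 val); rewrite /= (mk_monicE fbar_irr).
rewrite Pdiv.Ring.rmodp_small; last first.
  rewrite [ltnRHS]size_map_poly_id0 ?(eqP f_monic) ?rmorph1 ?oner_eq0 //.
  rewrite (leq_ltn_trans (size_poly _ _)) //.
  by rewrite -{2}mk_monic_basic_irreducible size_mk_monic.
move=> x0; apply: coef_red_mulpn => i.
by rewrite -coef_map /= x0 coef0.
Qed.

Lemma GR_mulpn_eq0 (x : {poly %/ f}) : x *+ p = 0 -> exists y, x = y *+ p.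
Proof.
move=> /(congr1 val); rewrite raddfMn /= => x0; apply: coef_red_mulpn => i.
by apply: Zp2_mulpn_eq0; rewrite -coefMn x0 coef0.
Qed.

Lemma GR_mulpnp (x : {poly %/ f}) : x *+ p *+ p = 0.
Proof.
apply: val_inj; rewrite !raddfMn /=; apply/polyP=> i.
by rewrite !coefMn coef0 Zp2_mulpnp.
Qed.

End GaloisRing.

(** * Galois rings inside the ambient ring *)

Lemma is_GR_subring (p r : nat) (G : finComNzRingType) (S : {set G}) :
  is_GR p r S -> subring_closed [in S].
Proof.
case=> f [_ [phi [_ Sphi]]].
split=> [|_ _ /Sphi[x <-] /Sphi[y <-]|_ _ /Sphi[x <-] /Sphi[y <-]]; apply/Sphi.
- by exists 1; rewrite rmorph1.
- by exists (x - y); rewrite rmorphB.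
- by exists (x * y); rewrite rmorphM.
Qed.

Lemma card_is_GR (p r : nat) (G : finComNzRingType) (S : {set G}) :
  prime p -> is_GR p r S -> #|S| = (p ^ (2 * r))%N.
Proof.
move=> p_prime [f [f_irr [phi [phi_inj Sphi]]]].
rewrite -(card_GR p_prime f_irr) -(card_imset _ phi_inj) -cardsE.
apply: eq_card => x; rewrite inE; apply/idP/imsetP.
  by case/Sphi=> y <-; exists y.
by case=> y _ ->; apply/Sphi; exists y.
Qed.

(** The residue field has p^r elements, so x^(p^r) - x has residue zero and is a multiple of p. *)
Lemma is_GR_Frobenius (p r : nat) (G : finComNzRingType) (S : {set G}) :
  prime p -> is_GR p r S ->
  {in S, forall x, exists2 y, y \in S & x ^+ (p ^ r) = x + y *+ p}.
Proof.
move=> p_prime [f [f_irr [phi [_ Sphi]]]] _ /Sphi[x <-].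
have [|y xy] := @residue_eq0 _ _ _ p_prime f_irr (x ^+ (p ^ r) - x).
  rewrite rmorphB rmorphXn /= -(card_residue_field p_prime f_irr).
  by rewrite expf_card subrr.
exists (phi y); first by apply/Sphi; exists y.
by rewrite -rmorphXn -rmorphMn -rmorphD -xy addrC subrK.
Qed.

(** [rho] is [residue] transported along the inverse of the presentation of G. Together with x^(p^R)
    = x modulo p, these are the properties from which the Frobenius is built. *)
Lemma is_GR_residue (p r : nat) (G : finComNzRingType) :
  prime p -> is_GR p r [set: G] ->
  exists (K : finFieldType) (rho : {rmorphism G -> K}),
    [/\ p \in [pchar K],
        forall x, rho x = 0 -> exists y, x = y *+ p,
        forall x : G, x *+ p = 0 -> exists y, x = y *+ p
      & forall x : G, x *+ p *+ p = 0].
Proof.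
move=> p_prime [f [f_irr [phi [phi_inj Sphi]]]].
have [|psi phiK psiK] := inj_card_bij phi_inj.
  rewrite -cardsT; suff /eqP -> : [set: G] == phi @: setT.
    by rewrite (leq_trans (leq_imset_card _ _)) // cardsT.
  rewrite eqEsubset subsetT andbT; apply/subsetP=> x /Sphi[y <-].
  exact: imset_f.
have psi_add : zmod_morphism psi := can2_zmod_morphism phiK psiK.
have psi_mul : monoid_morphism psi := can2_monoid_morphism phiK psiK.
pose psiR : {rmorphism G -> {poly %/ f}} := HB.pack psi
  (GRing.isZmodMorphism.Build _ _ psi psi_add)
  (GRing.isMonoidMorphism.Build _ _ psi psi_mul).
pose rho : {rmorphism G -> residue_field p_prime f_irr} :=
  residue p_prime f_irr \o psiR.
exists (residue_field p_prime f_irr), rho; split=> [|x|x px|x].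
- by rewrite pchar_qpoly pchar_Fp.
- by case/residue_eq0=> y xy; exists (phi y); rewrite -rmorphMn -xy psiK.
- have [|y xy] := @GR_mulpn_eq0 _ _ p_prime (psi x).
    by rewrite -[psi]/(psiR : _ -> _) -rmorphMn px rmorph0.
  by exists (phi y); rewrite -rmorphMn -xy psiK.
- by rewrite -[x]psiK -!rmorphMn GR_mulpnp // rmorph0.
Qed.

(** * The Frobenius automorphism of a Galois ring *)

Section Frobenius.

Variables (p R : nat) (G : finComNzRingType).
Variables (K : finFieldType) (rho : {rmorphism G -> K}).
Hypotheses (p_prime : prime p) (R_gt0 : (0 < R)%N) (charK : p \in [pchar K]).
Hypothesis rho_eq0 : forall x, rho x = 0 -> exists y, x = y *+ p.
Hypothesis mulpn_eq0 : forall x : G, x *+ p = 0 -> exists y, x = y *+ p.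
Hypothesis mulpnp : forall x : G, x *+ p *+ p = 0.
Hypothesis expQ : forall x : G, exists y, x ^+ (p ^ R) = x + y *+ p.

Implicit Types x y z X Y : G.

Lemma rho_mulpn x : rho (x *+ p) = 0.
Proof. by rewrite rmorphMn (mulrn_pchar charK). Qed.

Lemma rho_eqP x y : rho x = rho y -> exists z, x = y + z *+ p.
Proof.
move=> /eqP; rewrite -subr_eq0 -rmorphB => /eqP/rho_eq0[z xy].
by exists z; rewrite -xy addrC subrK.
Qed.

(** Both the kernel of [rho] and the annihilator of p are pG, so multiplication by p identifies the
    residue field with pG. *)
Lemma rho_eq_mulpn x y : rho x = rho y <-> x *+ p = y *+ p.
Proof.
split=> [/rho_eqP[z ->]|/eqP xy]; first by rewrite mulrnDl mulpnp addr0.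
move: xy; rewrite -subr_eq0 -(mulrnBl p) => /eqP/mulpn_eq0[z xy].
by apply/eqP; rewrite -subr_eq0 -rmorphB xy rho_mulpn.
Qed.

Lemma mulpnM x y : x *+ p * (y *+ p) = 0.
Proof. by rewrite mulrnAr mulrnAl mulpnp. Qed.

(** In x^p - y^p = (x - y) * sum, both factors are multiples of p: the sum has p terms with equal
    residues. Their product vanishes because p^2 = 0. *)
Lemma rho_eq_expp x y : rho x = rho y -> x ^+ p = y ^+ p.
Proof.
move=> xy; apply/eqP; rewrite -subr_eq0 subrXX.
have [z ->] : exists z, x - y = z *+ p.
  by apply: rho_eq0; rewrite rmorphB xy subrr.
have [w ->] : exists w, \sum_(i < p) x ^+ (p.-1 - i) * y ^+ i = w *+ p.
  apply: rho_eq0; rewrite rmorph_sum /= (eq_bigr (fun=> rho y ^+ p.-1)).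
    by rewrite sumr_const card_ord (mulrn_pchar charK).
  move=> i _; rewrite rmorphM !rmorphXn /= xy -exprD subnK //.
  by rewrite -ltnS prednK ?prime_gt0.
by rewrite mulpnM.
Qed.

(** The integral polynomial ((x + y)^p - x^p - y^p) / p, the carry in the addition of Witt vectors
    of length 2. *)
Definition witt_sum (x y : G) : G :=
  \sum_(1 <= i < p) (x ^+ (p - i) * y ^+ i) *+ ('C(p, i) %/ p).

Lemma exprpD x y : (x + y) ^+ p = x ^+ p + y ^+ p + witt_sum x y *+ p.
Proof.
have p_gt0 := prime_gt0 p_prime.
pose F i := x ^+ (p - i) * y ^+ i *+ 'C(p, i).
rewrite exprDn -(big_mkord xpredT F) big_ltn // big_nat_recr //= {1 3}/F.
rewrite bin0 binn subn0 subnn !expr0 mulr1 mul1r !mulr1n [RHS]addrAC -addrA.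
congr (_ + (_ + _)); rewrite -sumrMnl; apply: eq_big_nat => i /andP[i_gt0 ip].
by rewrite /F -mulrnA divnK // prime_dvd_bin // i_gt0.
Qed.

Lemma rho_witt_sum x y :
  rho (witt_sum x y) ^+ p = rho (witt_sum (x ^+ p) (y ^+ p)).
Proof.
rewrite -[_ ^+ p](pFrobenius_autE charK) /witt_sum !rmorph_sum /=.
apply: eq_bigr => i _; rewrite !rmorphMn !rmorphM !rmorphXn /=.
by rewrite !pFrobenius_autE.
Qed.

Lemma exprQ1 x : x ^+ (p ^ R) = (x ^+ (p ^ R.-1)) ^+ p.
Proof. by rewrite -exprM -expnSr prednK. Qed.

Lemma rho_expQ x : rho (x ^+ (p ^ R)) = rho x.
Proof. by have [y ->] := expQ x; rewrite rmorphD /= rho_mulpn addr0. Qed.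

Lemma rho_eq_expQ x y : rho x = rho y -> x ^+ (p ^ R) = y ^+ (p ^ R).
Proof.
move=> xy; rewrite -(prednK R_gt0) expnS !exprM.
by rewrite (rho_eq_expp xy).
Qed.

Lemma witt_decomp x : exists X y, x = X ^+ p + y *+ p.
Proof.
exists (x ^+ (p ^ R.-1)); have [y xy] := expQ x.
by exists (- y); rewrite -exprQ1 xy mulNrn addrK.
Qed.

(* If x = X^p + p y, then X^p is the Teichmuller part x^(p^R) of x, p y is
   determined by x, and the Frobenius of x is X^(p^2) + p y^p. *)
Definition sigma (x : G) : G :=
  (x ^+ (p ^ R)) ^+ p +
  odflt 0 [pick y | x - x ^+ (p ^ R) == y *+ p] ^+ p *+ p.

(** [sigma] may be computed from any decomposition: x^(p^R) recovers X^p, and p y determines the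
    residue of y, hence y^p. *)
Lemma sigmaE X y : sigma (X ^+ p + y *+ p) = (X ^+ p) ^+ p + y ^+ p *+ p.
Proof.
rewrite /sigma; set x := X ^+ p + y *+ p.
have xQ : x ^+ (p ^ R) = X ^+ p.
  have -> : x ^+ (p ^ R) = (X ^+ p) ^+ (p ^ R).
    by apply: rho_eq_expQ; rewrite /x rmorphD /= rho_mulpn addr0.
  by rewrite exprAC; apply: rho_eq_expp; rewrite rho_expQ.
rewrite xQ; congr (_ + _); case: pickP => [z|/(_ y)] /=; last first.
  by rewrite /x addrC addKr eqxx.
rewrite /x addrC addKr => /eqP/rho_eq_mulpn yz.
by rewrite (rho_eq_expp yz).
Qed.

(** Adding two decompositions produces the carry w = [witt_sum X Y] in the second coordinate.
    Applying [sigma] turns it into [witt_sum (X ^+ p) (Y ^+ p)] modulo p, which is exactly the carry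
    of the images. *)
Fact sigma_is_zmod_morphism : zmod_morphism sigma.
Proof.
have sD x y : sigma (x + y) = sigma x + sigma y.
  have [X [x1 ->]] := witt_decomp x; have [Y [y1 ->]] := witt_decomp y.
  pose w := witt_sum X Y.
  have -> : X ^+ p + x1 *+ p + (Y ^+ p + y1 *+ p) =
            (X + Y) ^+ p + (x1 + y1 - w) *+ p.
    rewrite exprpD -/w mulrnBl mulrnDl; set a := X ^+ p; set b := Y ^+ p.
    rewrite addrACA -[RHS]addrA; congr (_ + _).
    by rewrite [RHS]addrC subrK.
  rewrite !sigmaE.
  have -> : ((X + Y) ^+ p) ^+ p = (X ^+ p + Y ^+ p) ^+ p.
    by apply: rho_eq_expp; rewrite exprpD rmorphD /= rho_mulpn addr0.
  have -> : (x1 + y1 - w) ^+ p *+ p =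
     (x1 ^+ p + y1 ^+ p - witt_sum (X ^+ p) (Y ^+ p)) *+ p.
    apply/rho_eq_mulpn; rewrite rmorphXn !(rmorphB, rmorphD) /= !rmorphXn.
    rewrite -rho_witt_sum -!(pFrobenius_autE charK).
    by rewrite !(rmorphB, rmorphD).
  rewrite exprpD mulrnBl mulrnDl [RHS]addrACA -[LHS]addrA; congr (_ + _).
  by rewrite [LHS]addrC subrK.
by move=> x y; rewrite -[x in RHS](subrK y) [in RHS]sD addrK.
Qed.

Fact sigma_is_monoid_morphism : monoid_morphism sigma.
Proof.
split=> [|x y].
  have := sigmaE 1 0; rewrite mul0rn addr0 !expr1n expr0n.
  by rewrite eqn0Ngt prime_gt0 // mul0rn addr0.
have [X [x1 ->]] := witt_decomp x; have [Y [y1 ->]] := witt_decomp y.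
have -> : (X ^+ p + x1 *+ p) * (Y ^+ p + y1 *+ p) =
          (X * Y) ^+ p + (x1 * Y ^+ p + y1 * X ^+ p) *+ p.
  rewrite mulrDl !mulrDr mulpnM addr0 exprMn mulrnDl -!addrA; congr (_ + _).
  by rewrite addrC mulrnAl mulrnAr [y1 * _]mulrC.
rewrite !sigmaE mulrDl !mulrDr mulpnM addr0 exprMn exprMn -!addrA.
congr (_ + _); rewrite addrC mulrnAl mulrnAr -mulrnDl.
apply/rho_eq_mulpn.
rewrite rmorphXn -(pFrobenius_autE charK) !rmorphD !rmorphM /= !rmorphXn /=.
by rewrite !pFrobenius_autE [rho y1 ^+ p * _]mulrC.
Qed.

HB.instance Definition _ :=
  GRing.isZmodMorphism.Build G G sigma sigma_is_zmod_morphism.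
HB.instance Definition _ :=
  GRing.isMonoidMorphism.Build G G sigma sigma_is_monoid_morphism.

Definition sigma_rmorphism : {rmorphism G -> G} := sigma.

Lemma iter_sigma k a b : a ^+ (p ^ R) = a ->
  iter k sigma (a + b *+ p) = a ^+ (p ^ k) + b ^+ (p ^ k) *+ p.
Proof.
move=> aQ; elim: k => [|k /= ->]; first by rewrite !expr1.
have akQ : (a ^+ (p ^ k)) ^+ (p ^ R) = a ^+ (p ^ k) by rewrite exprAC aQ.
(* Being fixed by the p^R-th power, a^(p^k) is a p-th power, the form that [sigmaE] asks for. *)
by rewrite -{1}akQ exprQ1 sigmaE -exprQ1 akQ -!exprM -expnSr.
Qed.

(** The Teichmuller set described by an equation instead of a generator; [teichmuller_teich]
    reconciles the two. *)
Definition teich r : {set G} := [set x | x ^+ (p ^ r) == x].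

Lemma teich_dvd r t x : (r %| t)%N -> x \in teich r -> x \in teich t.
Proof.
case/dvdnP=> k -> {t}; rewrite !inE => /eqP xr.
elim: k => [|k IHk]; first by rewrite expr1.
by rewrite mulSn expnD exprM xr.
Qed.

Lemma rho_teich_inj : {in teich R &, injective rho}.
Proof.
by move=> x y; rewrite !inE => /eqP xQ /eqP yQ /rho_eq_expQ; rewrite xQ yQ.
Qed.

Lemma teich_decomp x : exists a b,
  [/\ a \in teich R, b \in teich R & x = a + b *+ p].
Proof.
have teichQ y : y ^+ (p ^ R) \in teich R.
  by rewrite inE; apply/eqP/rho_eq_expQ/rho_expQ.
have [y xy] := expQ x.
(* From x^(p^R) = x + p y: the element -y may be replaced by its own p^R-th power, which has the
   same residue and so the same multiple by p. *)
exists (x ^+ (p ^ R)), ((- y) ^+ (p ^ R)); split=> //.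
have /rho_eq_mulpn-> := rho_expQ (- y).
by rewrite mulNrn xy addrK.
Qed.

Lemma teich_decomp_inj a b a' b' :
  a \in teich R -> b \in teich R -> a' \in teich R -> b' \in teich R ->
  a + b *+ p = a' + b' *+ p -> a = a' /\ b = b'.
Proof.
move=> aT bT a'T b'T ab.
have aa' : a = a'.
  apply: rho_teich_inj => //; move: (congr1 rho ab).
  by rewrite !rmorphD /= !rho_mulpn !addr0.
split=> //; apply: rho_teich_inj => //.
by apply/rho_eq_mulpn/(addrI a); rewrite {2}aa'.
Qed.

Definition fixed r : {set G} := [set x | iter r sigma x == x].

(** The r-th iterate of [sigma] raises both Teichmuller coordinates to the power p^r, and these
    coordinates are unique. *)
Lemma fixedP r x : (r %| R)%N ->
  reflect (exists a b, [/\ a \in teich r, b \in teich r & x = a + b *+ p])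
          (x \in fixed r).
Proof.
rewrite inE => rR; apply: (iffP idP) => [|[a [b [aT bT ->]]]]; last first.
  have /[!inE]/eqP aQ := teich_dvd rR aT.
  rewrite iter_sigma //; move: aT bT.
  by rewrite !inE => /eqP-> /eqP->.
have [a [b [aT bT ->]]] := teich_decomp x.
have teichX c k : c \in teich R -> c ^+ k \in teich R.
  by rewrite !inE exprAC => /eqP->.
rewrite iter_sigma; last by apply/eqP; move: aT; rewrite inE.
case/eqP/teich_decomp_inj => // [||/eqP ar /eqP br]; try exact: teichX.
by exists a, b; rewrite !inE.
Qed.

(** [rho] embeds the set into the roots of X^(p^r) - X in the field K. *)
Lemma card_teich_le r : (0 < r)%N -> (r %| R)%N -> (#|teich r| <= p ^ r)%N.
Proof.
move=> r_gt0 rR.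
have q_gt1 : (1 < p ^ r)%N.
  by rewrite -(expn0 p) ltn_exp2l // prime_gt1.
rewrite cardE -(size_map rho).
pose P : {poly K} := 'X^(p ^ r) - 'X.
have sP : size P = (p ^ r).+1.
  by rewrite size_polyDl size_polyXn // size_polyN size_polyX.
rewrite -ltnS -sP; apply: max_poly_roots.
- by rewrite -size_poly_gt0 sP.
- apply/allP=> _ /mapP[x + ->]; rewrite mem_enum inE => /eqP xr.
  by rewrite rootE /P !hornerE -rmorphXn xr subrr.
- rewrite map_inj_in_uniq ?enum_uniq // => x y.
  by rewrite !mem_enum => xT yT; apply: rho_teich_inj; exact: teich_dvd rR _.
Qed.

Lemma card_fixed_le r : (r %| R)%N -> (#|fixed r| <= #|teich r| * #|teich r|)%N.
Proof.
move=> rR; rewrite -cardsX.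
apply: leq_trans (leq_imset_card (fun ab => ab.1 + ab.2 *+ p) _).
apply/subset_leq_card/subsetP=> x /(fixedP _ rR)[a [b [aT bT ->]]].
by apply/imsetP; exists (a, b); rewrite // inE aT.
Qed.

(** * Galois subrings as fixed rings of iterates of the Frobenius *)

Section GaloisSubring.

Variables (r : nat) (S : {set G}).
Hypotheses (r_gt0 : (0 < r)%N) (rR : (r %| R)%N) (S_GR : is_GR p r S).

(** The argument of [teich_decomp] runs inside S with exponent p^r, since the residues of elements
    of S are fixed by the p^r-th power. *)
Lemma is_GR_sub_fixed : S \subset fixed r.
Proof.
have [_ SB _] := is_GR_subring S_GR.
have S0 : 0 \in S by rewrite -(subrr 1) SB // ; case: (is_GR_subring S_GR).
have eq_expr x y : rho x = rho y -> x ^+ (p ^ r) = y ^+ (p ^ r).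
  move=> xy; rewrite -(prednK r_gt0) expnS !exprM.
  by rewrite (rho_eq_expp xy).
have rho_expr x : x \in S -> rho (x ^+ (p ^ r)) = rho x.
  move=> /(is_GR_Frobenius p_prime S_GR)[y _ ->].
  by rewrite rmorphD /= rho_mulpn addr0.
apply/subsetP=> x xS; apply/(fixedP _ rR).
have [y yS xy] := is_GR_Frobenius p_prime S_GR xS.
exists (x ^+ (p ^ r)), ((- y) ^+ (p ^ r)).
have NyS : - y \in S by rewrite -sub0r SB.
split; rewrite ?inE; try by apply/eqP/eq_expr/rho_expr.
have /rho_eq_mulpn-> := rho_expr _ NyS.
by rewrite mulNrn xy addrK.
Qed.

(** S already has p^(2r) elements, the largest size that pairs of Teichmuller coordinates allow. *)
Lemma is_GR_fixed : S = fixed r.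
Proof.
apply/eqP; rewrite eqEcard is_GR_sub_fixed (card_is_GR p_prime S_GR).
rewrite (leq_trans (card_fixed_le rR)) // mul2n -addnn expnD.
by rewrite leq_mul ?card_teich_le.
Qed.

Lemma card_teich : #|teich r| = (p ^ r)%N.
Proof.
apply/eqP; rewrite eqn_leq card_teich_le //= -(leq_sqr (p ^ r)).
rewrite -expnM mulnC -(card_is_GR p_prime S_GR) is_GR_fixed.
by rewrite -mulnn card_fixed_le.
Qed.

Let q_gt1 : (1 < p ^ r)%N.
Proof. by rewrite -(expn0 p) ltn_exp2l // prime_gt1. Qed.

(** The nonzero elements have p^r - 1 distinct residues, all roots of unity in a field, so one
    residue is primitive. The order lifts because [rho] is injective on Teichmuller elements. *)
Lemma teich_prim_root :
  exists2 xi, xi \in teich r & (p ^ r).-1.-primitive_root xi.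
Proof.
have N_gt0 : (0 < (p ^ r).-1)%N by rewrite -ltnS prednK // ltnW.
have teichR x : x \in teich r -> x \in teich R by exact: teich_dvd.
pose rs := [seq rho x | x <- enum (teich r :\ 0)].
have /hasP[_ /mapP[xi + ->] xi_prim] : has (p ^ r).-1.-primitive_root rs.
  apply: has_prim_root => //.
  - apply/allP=> _ /mapP[x + ->]; rewrite mem_enum !inE => /andP[x_neq0 xr].
    have rx_neq0 : rho x != 0.
      apply: contraNneq x_neq0 => rx0; apply/eqP/rho_teich_inj.
      + by apply: teichR; rewrite inE.
      + by rewrite inE expr0n expn_eq0 eqn0Ngt prime_gt0.
      by rewrite rx0 rmorph0.
    rewrite unity_rootE; apply/eqP/(mulfI rx_neq0).
    by rewrite -exprS prednK ?(ltnW q_gt1) // -rmorphXn (eqP xr) mulr1.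
  - rewrite map_inj_in_uniq ?enum_uniq // => x y.
    rewrite !mem_enum !inE => /andP[_ xT] /andP[_ yT]; apply: rho_teich_inj;
      by apply: teichR; rewrite inE.
  - rewrite size_map -cardE cardsDS; last first.
      by rewrite sub1set inE expr0n expn_eq0 eqn0Ngt prime_gt0.
    by rewrite cards1 card_teich subn1.
rewrite mem_enum inE => /andP[_ xiT]; exists xi => //.
have xiN : xi ^+ (p ^ r).-1 = 1.
  apply: rho_teich_inj.
  - by move: (teichR _ xiT); rewrite !inE exprAC => /eqP->.
  - by rewrite inE expr1n.
  by rewrite rmorphXn rmorph1 (prim_expr_order xi_prim).
have [k xi_k kN] := prim_order_exists N_gt0 xiN.
suff /eqP <- : k == (p ^ r).-1 by [].
rewrite eqn_dvd kN (prim_order_dvd xi_prim) -rmorphXn (prim_expr_order xi_k).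
by rewrite rmorph1 eqxx.
Qed.

Lemma teichmuller_teich : teichmuller p r S = teich r.
Proof.
rewrite /teichmuller; case: pickP => [xi /andP[_ xi_prim]|no_xi]; last first.
  have [xi xiT xi_prim] := teich_prim_root.
  have := no_xi xi; rewrite xi_prim andbT is_GR_fixed => /negP[].
  apply/(fixedP _ rR); exists xi, 0; split=> //; last by rewrite mul0rn addr0.
  by rewrite inE expr0n expn_eq0 eqn0Ngt prime_gt0.
have q0 : (p ^ r == 0)%N = false by rewrite expn_eq0 eqn0Ngt prime_gt0.
have xi_n0 k : xi ^+ k != 0.
  apply/eqP=> /(congr1 (fun x => x ^+ (p ^ r).-1)).
  rewrite /= exprAC (prim_expr_order xi_prim) expr1n expr0n -leqn0 leqNgt.
  by rewrite (prim_order_gt0 xi_prim) => /eqP; rewrite oner_eq0.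
apply/eqP; rewrite eqEcard; apply/andP; split.
  apply/subsetP=> x; rewrite !inE => /orP[/eqP->|/imsetP[i _ ->]].
    by rewrite expr0n q0.
  rewrite exprAC -[X in (xi ^+ X)]prednK ?(ltnW q_gt1) // exprS.
  by rewrite (prim_expr_order xi_prim) mulr1.
rewrite card_teich cardsU1 card_imset ?card_ord; last first.
  move=> i j /eqP; rewrite (eq_prim_root_expr xi_prim) !modn_small //.
  by move/eqP/val_inj.
case: imsetP => [[i _ /esym/eqP]|_]; first by rewrite (negPf (xi_n0 _)).
by rewrite add1n prednK // ltnW.
Qed.

(** Whichever Teichmuller decomposition is picked, [iter_sigma] evaluates the iterate on it to the
    same formula. *)
Lemma GR_conj_sigma x : x \in S -> GR_conj p r S x = iter r./2 sigma x.
Proof.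
rewrite {1}is_GR_fixed => /(fixedP _ rR)[a [b [aT bT xE]]].
rewrite /GR_conj teichmuller_teich.
case: pickP => [[a0 b0] /= /and3P[a0T b0T /eqP->]|/(_ (a, b))] /=; last first.
  by rewrite aT bT xE eqxx.
by rewrite iter_sigma //; apply/eqP; move: (teich_dvd rR a0T); rewrite inE.
Qed.

End GaloisSubring.

(** z^(|K| - 1) has residue 1, so its p-th power is 1 in G, and a power of z is an inverse. *)
Lemma rho_neq0_unit z : rho z != 0 -> exists w, w * z = 1.
Proof.
move=> rz0; have K_gt1 := card_finNzRing_gt1 K.
have zN : (z ^+ #|K|.-1) ^+ p = 1.
  rewrite -(expr1n G p); apply: rho_eq_expp; apply: (mulfI rz0).
  by rewrite rmorphXn -exprS prednK ?(ltnW K_gt1) // expf_card rmorph1 mulr1.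
exists (z ^+ (#|K|.-1 * p).-1); rewrite -exprSr prednK ?exprM //.
by rewrite muln_gt0 (prime_gt0 p_prime) andbT -ltnS prednK // ltnW.
Qed.

(** Were z - 1 in the kernel of [rho], z^p would be 1; the order of z would divide both p and m,
    forcing z = 1. *)
Lemma unity_root_sub1_unit m z :
  ~~ (p %| m)%N -> z ^+ m = 1 -> z != 1 -> exists w, w * (z - 1) = 1.
Proof.
move=> pNm zm z_neq1; apply: rho_neq0_unit.
apply: contraNneq z_neq1 => /eqP; rewrite rmorphB rmorph1 subr_eq0 => /eqP rz1.
have zp : z ^+ p = 1.
  by rewrite -(expr1n G p); apply: rho_eq_expp; rewrite rmorph1.
have [k zk kp] := prim_order_exists (prime_gt0 p_prime) zp.
have : (k %| m)%N by rewrite (prim_order_dvd zk) zm.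
have /orP[/eqP k1|/eqP->] : (k == 1)%N || (k == p).
  by case/primeP: p_prime => _ ->.
  by rewrite -[z]expr1 -k1 (prim_expr_order zk).
by rewrite (negPf pNm).
Qed.

Lemma natr_unit m : ~~ (p %| m)%N -> exists w : G, w * m%:R = 1.
Proof.
by move=> pNm; apply: rho_neq0_unit; rewrite rmorph_nat -(dvdn_pcharf charK).
Qed.

End Frobenius.

(** Gathers what the duality argument uses of the Galois rings beyond their cardinality. *)
Lemma GR_tower_Frobenius (p R : nat) (G : finComNzRingType)
    (GR : nat -> {set G}) :
  prime p -> (0 < R)%N -> GR_tower p R GR ->
  exists sigma : {rmorphism G -> G},
  [/\ forall r, (r %| R)%N -> GR r = [set x | iter r sigma x == x],
      forall r x, (r %| R)%N -> x \in GR r ->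
        GR_conj p r (GR r) x = iter r./2 sigma x,
      forall z : G, z ^+ (p ^ R) = z -> sigma z = z ^+ p,
      forall m (z : G), ~~ (p %| m)%N -> z ^+ m = 1 -> z != 1 ->
        exists w, w * (z - 1) = 1
    & forall m, ~~ (p %| m)%N -> exists w : G, w * m%:R = 1].
Proof.
move=> p_prime R_gt0 [GR_R GR_r].
have G_GR : is_GR p R [set: G] by rewrite -GR_R; apply: GR_r.
have [K [rho [charK rho_eq0 mulpn_eq0 mulpnp]]] := is_GR_residue p_prime G_GR.
have expQ (x : G) : exists y, x ^+ (p ^ R) = x + y *+ p.
  by have [y _ xy] := is_GR_Frobenius p_prime G_GR (in_setT x); exists y.
have r_gt0 r : (r %| R)%N -> (0 < r)%N by exact: dvdn_gt0.
exists (sigma_rmorphism p_prime R_gt0 charK rho_eq0 mulpn_eq0 mulpnp expQ).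
split=> [r rR|r x rR xS|z zQ|m z|m] /=.
- exact: (is_GR_fixed p_prime R_gt0 charK rho_eq0 mulpn_eq0 mulpnp expQ
    (r_gt0 _ rR) rR (GR_r _ rR)).
- exact: (GR_conj_sigma p_prime R_gt0 charK rho_eq0 mulpn_eq0 mulpnp expQ
    (r_gt0 _ rR) rR (GR_r _ rR)).
- have := iter_sigma p_prime R_gt0 charK rho_eq0 mulpn_eq0 mulpnp expQ 1 0 zQ.
  by rewrite /= mul0rn addr0 expn1 expr0n eqn0Ngt prime_gt0 // mul0rn addr0.
- exact: (unity_root_sub1_unit p_prime charK rho_eq0 mulpnp).
- exact: (natr_unit p_prime charK rho_eq0 mulpnp).
Qed.

(** * The discrete Fourier transform *)

Lemma big_ord_mul_add (V : nmodType) (m n : nat) (F : nat -> V) :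
  \sum_(i < m) \sum_(j < n) F (i + j * m)%N = \sum_(t < m * n) F t.
Proof.
rewrite exchange_big /=; elim: n => [|n IHn]; first by rewrite muln0 !big_ord0.
rewrite big_ord_recr IHn mulnSr big_split_ord /=; congr (_ + _).
by apply: eq_bigr => i _; rewrite addnC mulnC.
Qed.

Lemma size_mk_monic_Xn_sub1 (A : nzRingType) (n : nat) : (0 < n)%N ->
  size (mk_monic ('X^n - 1 : {poly A})) = n.+1.
Proof.
move=> n_gt0; have sn : size ('X^n - 1 : {poly A}) = n.+1.
  by rewrite size_polyDl size_polyXn // size_polyN size_poly1 ltnS.
by rewrite /mk_monic sn monicXnsubC // ltnS n_gt0.
Qed.

Section DiscreteFourierTransform.

Variables (p a m : nat) (G : finComNzRingType) (m' : int) (zeta : G).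
Hypotheses (p_prime : prime p) (m_gt0 : (0 < m)%N).
Hypothesis m'_inv : (m%:Z * m' = 1 %[mod (p ^ a)%:Z])%Z.
Hypothesis zeta_m : zeta ^+ m = 1.

Local Notation N := (p ^ a)%N.
Local Notation n := (m * p ^ a)%N.
Implicit Types (c d : 'rV[G]_n) (h t : nat).

Let N_gt0 : (0 < N)%N. Proof. by rewrite expn_gt0 prime_gt0. Qed.
Let N_neq0 : N%:Z != 0. Proof. by rewrite eqz_nat -lt0n. Qed.

Lemma coef_upow (k : int) i :
  (upow p a G k : {poly G})`_i = (i == `|(k %% N%:Z)%Z|%N)%:R.
Proof.
rewrite /upow; set r := `|_|%N.
have r_lt : (r < N)%N.
  by rewrite -ltz_nat gez0_abs ?modz_ge0 // ltz_pmod // ltz_nat.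
have -> : 'qX ^+ r = in_qpoly ('X^N - 1 : {poly G}) 'X^r by rewrite rmorphXn.
rewrite in_qpoly_small ?coefXn // size_polyXn size_mk_monic_Xn_sub1 //.
Qed.

(** The exponent of u that position t contributes when X is evaluated at zeta^h u^m'. *)
Definition uexp t : nat := `|((m' * t%:Z) %% N%:Z)%Z|%N.

Lemma uexp_lt t : (uexp t < N)%N.
Proof. by rewrite -ltz_nat gez0_abs ?modz_ge0 // ltz_pmod // ltz_nat. Qed.

Lemma eq_uexp t t' : (uexp t == uexp t') = (t == t' %[mod N])%N.
Proof.
rewrite -eqz_nat !gez0_abs ?modz_ge0 // -[RHS]eqz_nat -!modz_nat.
apply/eqP/eqP=> tt'; last by rewrite -modzMmr tt' modzMmr.
have mm' (k : int) : (k = m%:Z * (m' * k) %[mod N%:Z])%Z.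
  by rewrite mulrA -modzMml m'_inv modzMml mul1r.
by rewrite mm' -modzMmr tt' modzMmr -mm'.
Qed.

Lemma coef_dft c h i :
  (dft m' zeta c h : {poly G})`_i =
  \sum_(t < n) c 0 t * zeta ^+ (h * t) *+ (i == uexp t).
Proof.
transitivity (\sum_(t < n) ((rVpoly c)`_t * zeta ^+ (h * t) *+ (i == uexp t))).
  rewrite -(big_ord_mul_add _ _ (fun t =>
    (rVpoly c)`_t * zeta ^+ (h * t) *+ (i == uexp t))).
  rewrite /dft coefn_sum; apply: eq_bigr => j _.
  rewrite coefn_sum; apply: eq_bigr => k _.
  rewrite poly_of_qpolyZ coefZ coef_upow mulr_natr.
  (* As m m' = 1 modulo p^a, the exponent m'(j + k m) reduces to m' j + k. *)
  have -> : uexp (j + k * m) = `|((m' * j%:Z + k%:Z) %% N%:Z)%Z|%N; last first.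
    congr (_ * _ *+ _).
    have zk : zeta ^+ (h * (k * m)) = 1.
      by rewrite mulnA mulnC exprM zeta_m expr1n.
    by rewrite mulnDr exprD zk mulr1.
  congr `|_|%N; rewrite PoszD PoszM mulrDr -modzDmr -[RHS]modzDmr.
  congr ((_ + _) %% _)%Z; rewrite mulrCA [m' * _]mulrC -modzMmr m'_inv.
  by rewrite modzMmr mulr1.
by apply: eq_bigr => t _; rewrite coef_rVpoly_ord.
Qed.

Lemma dft_coefs c h k :
  coefs (dft m' zeta c h) 0 k =
  \sum_(t < n) c 0 t * zeta ^+ (h * t) *+ (k == uexp t :> nat).
Proof. by rewrite mxE coef_dft. Qed.

Lemma dotE_dft c d h h' :
  dotE (coefs (dft m' zeta c h)) (coefs (dft m' zeta d h')) =
  \sum_(t < n) \sum_(t' < n)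
    (c 0 t * d 0 t') * zeta ^+ (h * t + h' * t') *+ (t == t' %[mod N])%N.
Proof.
rewrite /dotE.
under eq_bigr do rewrite !dft_coefs big_distrlr /=.
rewrite exchange_big; apply: eq_bigr => t _.
rewrite exchange_big; apply: eq_bigr => t' _ /=.
rewrite (bigD1 (Ordinal (uexp_lt t))) //= big1 => [|k]; last first.
  by rewrite -val_eqE => /negPf /= ->; rewrite mul0r.
rewrite eqxx addr0 mulr1n eq_uexp exprD mulrnAr; congr (_ *+ _).
by rewrite mulrACA.
Qed.

Lemma iter_cshift l c i :
  (iter l (@cshift G n) c) 0 i = c 0 (iter l (@ord_pred n) i).
Proof. by elim: l i => // l IHl i; rewrite iterS mxE IHl -iterSr. Qed.

Lemma iter_ord_pred k l (i : 'I_k) :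
  (iter l (@ord_pred k) i + l = i %[mod k])%N.
Proof.
elim: l => [|l IHl]; first by rewrite addn0.
rewrite -[in RHS]IHl /= modnDml addnS -addSn prednK; last first.
  by rewrite addn_gt0 (leq_ltn_trans (leq0n i) (ltn_ord i)) orbT.
by rewrite addnAC modnDr.
Qed.

Lemma dft_orthogonal (C : {set 'rV[G]_n}) c d h h' :
  {in C, forall v, cshift v \in C} -> c \in C ->
  {in C, forall v, dotE v d = 0} -> (m %| h + h')%N ->
  dotE (coefs (dft m' zeta c h)) (coefs (dft m' zeta d h')) = 0.
Proof.
move=> C_shift cC dC hh'; rewrite dotE_dft exchange_big /=.
have expz t t' : (t = t' %[mod m])%N -> zeta ^+ t = zeta ^+ t'.
  by move=> tt'; rewrite -(expr_mod t zeta_m) tt' expr_mod.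
(* Put t = t' - l: the entry of c at t is the entry at t' of its l-fold shift, the congruence modulo
   p^a becomes p^a | l, and h t + h' t' = (h + h') t + h' l reduces to h' l modulo m. *)
transitivity (\sum_(t' < n) \sum_(l < n)
   (zeta ^+ (h' * l) *+ (N %| l)%N) * (iter l (@cshift G n) c 0 t' * d 0 t')).
  apply: eq_bigr => t' _.
  rewrite (reindex_inj (h := fun l : 'I_n => iter l (@ord_pred n) t')) /=.
  2: {
    move=> l l' ll'; apply/val_inj/eqP.
    rewrite -[_ == _]/(l == l' :> nat) -(modn_small (ltn_ord l)).
    rewrite -(modn_small (ltn_ord l')) -(eqn_modDl (iter l (@ord_pred n) t')).
    by rewrite iter_ord_pred ll' iter_ord_pred. }
  apply: eq_bigr => l _; rewrite iter_cshift; set t := iter l _ _.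
  have tl : (t + l = t' %[mod n])%N by exact: iter_ord_pred.
  have tl_m : (t + l = t' %[mod m])%N.
    by rewrite -(modn_dvdm _ (dvdn_mulr N (dvdnn m))) tl modn_dvdm // dvdn_mulr.
  have tl_N : (t + l = t' %[mod N])%N.
    by rewrite -(modn_dvdm _ (dvdn_mull m (dvdnn N))) tl modn_dvdm // dvdn_mull.
  have -> : (t == t' %[mod N])%N = (N %| l)%N.
    by rewrite -tl_N -{1}[nat_of_ord t]addn0 eqn_modDl eq_sym mod0n.
  rewrite mulrnAl [in RHS]mulrC; congr (_ * _ *+ _); apply: expz.
  rewrite -modnDmr -modnMmr -tl_m modnMmr modnDmr mulnDr addnA -mulnDl.
  by rewrite -modnDml -modnMml (eqP hh') mul0n mod0n.
rewrite exchange_big big1 //= => l _; rewrite -mulr_sumr.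
have -> : \sum_i iter l (@cshift G n) c 0 i * d 0 i = 0 by
  apply: dC; elim: (val l) => //= k IHk; apply: C_shift.
by rewrite mulr0.
Qed.

Hypothesis pNm : ~~ (p %| m)%N.
Hypothesis zeta_prim : m.-primitive_root zeta.
Hypothesis unit_sub1 :
  forall z : G, z ^+ m = 1 -> z != 1 -> exists w, w * (z - 1) = 1.

Lemma sum_unity_root (z : G) : z ^+ m = 1 -> z != 1 -> \sum_(h < m) z ^+ h = 0.
Proof.
move=> zm z_neq1; have [w wz] := unit_sub1 zm z_neq1.
by rewrite -[LHS]mul1r -wz -mulrA -subrX1 zm subrr mulr0.
Qed.

Lemma parseval_dft c d :
  \sum_(h < m) dotE (coefs (dft m' zeta c h))
                    (coefs (dft m' zeta d (ord_opp h))) = dotE c d *+ m.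
Proof.
under eq_bigr do rewrite dotE_dft.
rewrite exchange_big -sumrMnl; apply: eq_bigr => t _ /=.
rewrite exchange_big /=.
have expz k k' : (k = k' %[mod m])%N -> zeta ^+ k = zeta ^+ k'.
  by move=> kk'; rewrite -(expr_mod k zeta_m) kk' expr_mod.
(* [m.-1] stands for -1 modulo m, which keeps the exponent a multiple of h in the natural
   numbers. *)
have zE (h : 'I_m) t' :
    zeta ^+ (h * t + ord_opp h * t') = (zeta ^+ (t + m.-1 * t')) ^+ h.
  rewrite -exprM; apply: expz => /=.
  rewrite mulnDl [(h * t)%N]mulnC -modnDmr modnMml modnDmr.
  apply/eqP; rewrite eqn_modDl -(eqn_modDr (h * t')) -mulnDl subnK; last first.
    exact: ltnW.
  rewrite -mulnA [(t' * h)%N]mulnC -mulSnr prednK //.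
  by rewrite !modnMr.
under eq_bigr => t' _.
  under eq_bigr do rewrite zE -mulrnAr.
  rewrite -mulr_sumr sumrMnl.
  over.
rewrite (bigD1 t) //= [X in _ + X]big1 ?addr0 => [|t' t'_neq].
  rewrite eqxx mulr1n. rewrite -[RHS]mulr_natr; congr (_ * _).
  rewrite -mulSn prednK // exprM zeta_m expr1n.
  under eq_bigr do rewrite expr1n.
  by rewrite sumr_const card_ord.
have [tt'_N|] := boolP (t == t' %[mod N])%N; last by rewrite mulr0n mulr0.
rewrite mulr1n sum_unity_root ?mulr0 //; first by rewrite exprAC zeta_m expr1n.
(* If zeta^(t - t') were 1, then t and t' would agree modulo m as well as modulo p^a, hence be equal
   by the Chinese remainder theorem. *)
rewrite -(prim_order_dvd zeta_prim); apply: contra t'_neq => m_tt'.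
have tt'_m : (t == t' %[mod m])%N.
  by rewrite -(eqn_modDr (m.-1 * t')) -mulSn prednK // modnMr.
have co_mN : coprime m N.
  by rewrite coprime_sym coprimeXl // prime_coprime.
have : (t == t' %[mod n])%N by rewrite chinese_remainder // tt'_m tt'_N.
by rewrite !modn_small // eq_sym.
Qed.

Lemma dft_coefsB c d h :
  coefs (dft m' zeta (c - d) h) =
  coefs (dft m' zeta c h) - coefs (dft m' zeta d h).
Proof.
apply/rowP=> k; rewrite !mxE !coef_dft -sumrB; apply: eq_bigr => t _.
by rewrite !mxE mulrBl mulrnBl.
Qed.

Lemma coefs_inj : injective (@coefs p a G).
Proof.
move=> x y /rowP xy; apply: val_inj; apply/polyP=> i.
have [iN|Ni] := ltnP i N; first by have := xy (Ordinal iN); rewrite !mxE.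
by rewrite !big_coef_npoly // size_mk_monic_Xn_sub1.
Qed.

Hypothesis unit_m : exists w : G, w * m%:R = 1.

(** Parseval against a unit vector shows that m times each entry of c - d is zero, and m is a
    unit. *)
Lemma dft_inj c d :
  (forall h : 'I_m, dft m' zeta c h = dft m' zeta d h) -> c = d.
Proof.
move=> cd; apply/eqP; rewrite -subr_eq0; apply/eqP/rowP=> t; rewrite [RHS]mxE.
have [w wm] := unit_m.
have : dotE (c - d) (delta_mx 0 t) *+ m = 0.
  rewrite -parseval_dft big1 // => h _; rewrite dft_coefsB cd subrr.
  by rewrite /dotE big1 // => i _; rewrite mxE mul0r.
rewrite /dotE (bigD1 t) //= big1 => [|i /negPf it]; last first.
  by rewrite [delta_mx _ _ _ _]mxE eqxx it mulr0.
rewrite [delta_mx _ _ _ _]mxE !eqxx mulr1 addr0 -mulr_natl.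
by move=> /(congr1 ( *%R w)); rewrite mulrA wm mul1r mulr0.
Qed.

End DiscreteFourierTransform.

(** * Duality under the transform *)

Lemma card_words (G : finComNzRingType) (n : nat) (S : {set G}) :
  #|words n S| = (#|S| ^ n)%N.
Proof.
rewrite -[n in RHS]card_ord -card_ffun_on.
rewrite -(card_in_imset (f := fun f : {ffun 'I_n -> G} => \row_i f i)).
2: by move=> f g _ _ /rowP fg; apply/ffunP=> i; have := fg i; rewrite !mxE.
apply: eq_card => v; rewrite inE.
apply/forallP/imsetP => [vS|[f /ffun_onP fS ->] i].
  exists [ffun i => v 0 i]; first by apply/ffun_onP=> i; rewrite ffunE.
  by apply/rowP=> i; rewrite mxE ffunE.
by rewrite mxE.
Qed.

Lemma card_Ru_sub_le (p a : nat) (G : finComNzRingType) (S : {set G}) :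
  prime p -> (#|@Ru_sub p a G S| <= #|S| ^ (p ^ a))%N.
Proof.
move=> p_prime; rewrite -card_words.
rewrite -(card_imset (@Ru_sub p a G S) (coefs_inj p_prime)).
by apply/subset_leq_card/subsetP=> _ /imsetP[x + ->]; rewrite inE.
Qed.

Lemma iter_rmorphism (G : nzRingType) (sigma : {rmorphism G -> G}) (k : nat) :
  exists phi : {rmorphism G -> G}, phi =1 iter k sigma.
Proof.
elim: k => [|k [phi phiE]]; first by exists idfun.
by exists (sigma \o phi) => x /=; rewrite phiE.
Qed.

Section SelfDuality.

Variables (p s a m M : nat) (G : finComNzRingType) (GR : nat -> {set G}).
Variables (zeta : G) (m' : int) (sigma phi : {rmorphism G -> G}).
Hypotheses (p_prime : prime p) (s_gt0 : (0 < s)%N) (m_gt0 : (0 < m)%N).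
Hypotheses (pNm : ~~ (p %| m)%N) (M_order : is_mult_order m (p ^ s) M).
Hypothesis zeta_prim : m.-primitive_root zeta.
Hypothesis m'_inv : (m%:Z * m' = 1 %[mod (p ^ a)%:Z])%Z.
Hypothesis GR_card : forall r, (r %| s * M)%N -> #|GR r| = (p ^ (2 * r))%N.
Hypothesis GR_fixed :
  forall r, (r %| s * M)%N -> GR r = [set x | iter r sigma x == x].
Hypothesis GR_conjE : forall r x, (r %| s * M)%N -> x \in GR r ->
  GR_conj p r (GR r) x = iter r./2 sigma x.
Hypothesis phiE : phi =1 iter s sigma.
Hypothesis phi_zeta : phi zeta = zeta ^+ (p ^ s).
Hypothesis unit_sub1 :
  forall z : G, z ^+ m = 1 -> z != 1 -> exists w, w * (z - 1) = 1.
Hypothesis unit_m : exists w : G, w * m%:R = 1.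

Local Notation n := (m * p ^ a)%N.
Local Notation f := (@ord_scale m (p ^ s)).
Local Notation deg h := (s * #|cyc_coset (p ^ s) h|)%N.
Local Notation dft := (@dft p a m G m' zeta).
Implicit Types (c d : 'rV[G]_n) (h : 'I_m).

Let zeta_m : zeta ^+ m = 1. Proof. exact: prim_expr_order. Qed.

Lemma iter_phi k x : iter k phi x = iter (s * k) sigma x.
Proof. by elim: k => [|k IHk]; rewrite ?muln0 // mulnS iterD -IHk -phiE. Qed.

Lemma deg_dvd h : (deg h %| s * M)%N.
Proof.
rewrite dvdn_pmul2l //; apply: (card_cyc_coset_dvd M_order).
exact: (iter_mult_order M_order).
Qed.

Lemma mem_GR_deg h x :
  (x \in GR (deg h)) = (iter #|cyc_coset (p ^ s) h| phi x == x).
Proof. by rewrite (GR_fixed (deg_dvd h)) inE iter_phi. Qed.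

Lemma phi_GR x : x \in GR s -> phi x = x.
Proof. by rewrite GR_fixed ?dvdn_mulr // inE phiE => /eqP. Qed.

(** [phi] fixes the entries of c and sends zeta to zeta^(p^s). *)
Lemma coefs_dft_scale c h : c \in words n (GR s) ->
  coefs (dft c (f h)) = map_mx phi (coefs (dft c h)).
Proof.
rewrite inE => /forallP cS; apply/rowP=> i.
rewrite [RHS]mxE !(dft_coefs p_prime m'_inv zeta_m) rmorph_sum.
apply: eq_bigr => t _; rewrite rmorphMn rmorphM rmorphXn /= phi_GR // phi_zeta.
rewrite -exprM; congr (_ * _ *+ _).
rewrite -(expr_mod _ zeta_m) -[RHS](expr_mod _ zeta_m); congr (_ ^+ _).
by rewrite modnMml mulnA [(p ^ s * _)%N]mulnC.
Qed.

Lemma coefs_dft_iter c h k : c \in words n (GR s) ->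
  coefs (dft c (iter k f h)) = map_mx (iter k phi) (coefs (dft c h)).
Proof.
move=> cS; elim: k => [|k IHk]; first by apply/rowP=> i; rewrite !mxE.
by rewrite iterS coefs_dft_scale // IHk; apply/rowP=> i; rewrite !mxE.
Qed.

(** The cycle of h closes after m_h steps, so the coefficients are fixed by the m_h-th iterate of
    [phi]. *)
Lemma dft_Ru_sub c h : c \in words n (GR s) ->
  dft c h \in Ru_sub p a (GR (deg h)).
Proof.
move=> cS; rewrite !inE; apply/forallP=> i; rewrite mem_GR_deg.
have := coefs_dft_iter h #|cyc_coset (p ^ s) h| cS.
rewrite (iter_card_cyc_coset M_order) => /rowP/(_ i).
by rewrite [in RHS]mxE => <-.
Qed.

Lemma dotE_map (k : nat) (v w : 'rV[G]_k) :
  dotE (map_mx phi v) (map_mx phi w) = phi (dotE v w).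
Proof.
by rewrite /dotE rmorph_sum; apply: eq_bigr => i _; rewrite !mxE rmorphM.
Qed.

Lemma dotE_dft_iter c d h k : c \in words n (GR s) -> d \in words n (GR s) ->
  dotE (coefs (dft c h)) (coefs (dft d (ord_opp h))) = 0 ->
  dotE (coefs (dft c (iter k f h))) (coefs (dft d (ord_opp (iter k f h)))) = 0.
Proof.
move=> cS dS cd0; elim: k => // k IHk.
by rewrite iterS ord_opp_scale !coefs_dft_scale // dotE_map IHk rmorph0.
Qed.

Section Representatives.

Variables J0 J1 J2 : {set 'I_m}.
Hypotheses (J0_reps : coset_reps (p ^ s) J0 (I0 m))
  (J1_reps : coset_reps (p ^ s) J1 (I1 m (p ^ s)))
  (J2_reps : coset_reps (p ^ s) J2 (I2 m (p ^ s)))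
  (J2_opp : forall h : 'I_m, (h \in J2) = (ord_opp h \in J2)).
Local Notation J := (J0 :|: J1 :|: J2).

Lemma dft_inj_reps : {in words n (GR s) &, forall c d,
  (forall h, h \in J -> dft c h = dft d h) -> c = d}.
Proof.
move=> c d cS dS cd.
apply: (dft_inj p_prime m_gt0 m'_inv zeta_m pNm zeta_prim unit_sub1) => // h.
have [j jJ [k ->]] := reps_cover M_order J0_reps J1_reps J2_reps h.
by apply: (coefs_inj p_prime); rewrite !coefs_dft_iter // cd.
Qed.

Lemma dft_on_inj : {in words n (GR s) &, injective (dft_on m' zeta J)}.
Proof.
move=> c d cS dS cd; apply: dft_inj_reps => // h hJ.
by have /ffunP/(_ (exist _ h hJ)) := cd; rewrite !ffunE.
Qed.

(** There are p^(2 s m p^a) words, and the target has at most p^(2 s p^a S) elements, with S the sum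
    of the m_j over J. As S <= m, the injective transform is onto. *)
Lemma dft_on_surj (y : {ffun {h : 'I_m | h \in J} -> Ru G p a}) :
  (forall h : {h : 'I_m | h \in J}, y h \in Ru_sub p a (GR (deg (val h)))) ->
  exists2 c, c \in words n (GR s) & dft_on m' zeta J c = y.
Proof.
move=> yS.
pose Y := [set y : {ffun {h : 'I_m | h \in J} -> Ru G p a} |
  [forall h : {h : 'I_m | h \in J}, y h \in Ru_sub p a (GR (deg (val h)))]].
suff imY : dft_on m' zeta J @: words n (GR s) = Y.
  have /imsetP[c cS ->] : y \in dft_on m' zeta J @: words n (GR s).
    by rewrite imY inE; apply/forallP.
  by exists c.
apply/eqP; rewrite eqEcard (card_in_imset dft_on_inj); apply/andP; split.
  apply/subsetP=> _ /imsetP[c cS ->]; rewrite inE; apply/forallP=> h.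
  by rewrite ffunE dft_Ru_sub.
have -> : #|Y| = #|family (fun h : {h : 'I_m | h \in J} =>
                            mem (Ru_sub p a (GR (deg (val h)))))|.
  by apply: eq_card => z; rewrite inE; apply/forallP/familyP.
rewrite card_family foldrE big_map big_enum /=.
apply: (@leq_trans
  (\prod_(h : {h : 'I_m | h \in J}) p ^ (2 * deg (val h) * p ^ a))).
  apply: leq_prod => h _; apply: leq_trans (card_Ru_sub_le _ _ p_prime) _.
  by rewrite GR_card ?deg_dvd // -expnM.
rewrite -expn_sum card_words GR_card ?dvdn_mulr // -expnM.
rewrite -(big_sub (mem J) (fun h => 2 * deg h * p ^ a)%N).
rewrite leq_exp2l ?prime_gt1 // -big_distrl mulnA leq_mul2r; apply/orP; right.
rewrite -big_distrr -mulnA leq_mul2l /= -big_distrr leq_mul2l; apply/orP; right.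
exact: (sum_card_reps M_order J0_reps J1_reps J2_reps).
Qed.

Lemma mem_Ru_dualE (S : {set G}) (I : {set Ru G p a}) x : x \in Ru_sub p a S ->
  (x \in Ru_dualE S I) = [forall y in I, dotE (coefs y) (coefs x) == 0].
Proof.
rewrite inE => xS; rewrite inE [_ \in dualE _ _]inE xS /=.
apply/forall_inP/forall_inP=> [x0 y yI|x0 _ /imsetP[y yI ->]]; last exact: x0.
by apply: x0; apply: imset_f.
Qed.

Lemma mem_Ru_dualH r (S : {set G}) (I : {set Ru G p a}) x :
  x \in Ru_sub p a S ->
  (x \in Ru_dualH r S I) = [forall y in I, dotH p r S (coefs y) (coefs x) == 0].
Proof.
rewrite inE => xS; rewrite inE [_ \in dualH _ _ _ _]inE xS /=.
apply/forall_inP/forall_inP=> [x0 y yI|x0 _ /imsetP[y yI ->]]; last exact: x0.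
by apply: x0; apply: imset_f.
Qed.

(** Conjugation on GR(p^2, s m_h) is the iterate of [phi] of order m_h/2, the one carrying the
    component at h to the component at -h. *)
Lemma dotH_dft_I1 c h v : c \in words n (GR s) -> h \in I1 m (p ^ s) ->
  dotH p (deg h) (GR (deg h)) v (coefs (dft c h)) =
  dotE v (coefs (dft c (ord_opp h))).
Proof.
move=> cS /(half_cyc_coset_I1 M_order)[k kE <-].
rewrite coefs_dft_iter //; apply: eq_bigr => i _; congr (_ * _).
rewrite [RHS]mxE GR_conjE ?deg_dvd //; last first.
  by have := dft_Ru_sub h cS; rewrite !inE => /forallP.
by rewrite iter_phi kE -doubleMr doubleK.
Qed.

Variable D : 'I_m -> {set Ru G p a}.

Let D' h := if h \in J0 then Ru_dualE (GR (deg h)) (D h)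
  else if h \in J1 then Ru_dualH (deg h) (GR (deg h)) (D h)
  else Ru_dualE (GR (deg (ord_opp h))) (D (ord_opp h)).

(* The index whose component of C the component of the dual at h is
   orthogonal to. *)
Let star h := if h \in J2 then ord_opp h else h.

Lemma star_reps h : h \in J -> star h \in J.
Proof.
by rewrite /star; case: ifP => // hJ _; rewrite !inE -J2_opp hJ orbT.
Qed.

Lemma starK : involutive star.
Proof.
move=> h; rewrite {2}/star; case: ifP => hJ; last by rewrite /star hJ.
by rewrite /star -J2_opp hJ (ord_oppK h).
Qed.

(** One Euclidean condition covers all three cases: on [J0], -h = h; on [J1], [dotH_dft_I1] applies;
    on [J2], [star h] is -h, whose opposite is h again. *)
Lemma mem_dual_component d h : d \in words n (GR s) -> h \in J ->
  (dft d h \in D' h) = [forall y in D (star h),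
    dotE (coefs y) (coefs (dft d (ord_opp (star h)))) == 0].
Proof.
move=> dS hJ; rewrite /D' /star; case: ifP => h0.
  have -> : (h \in J2) = false.
    by apply/negP=> /(reps_J2 J0_reps J1_reps J2_reps); rewrite h0.
  by rewrite mem_Ru_dualE ?dft_Ru_sub // (reps_J0 J0_reps).
case: ifP => h1.
  have -> : (h \in J2) = false.
    by apply/negP=> /(reps_J2 J0_reps J1_reps J2_reps); rewrite h1 andbF.
  have /andP[hI1 _] := reps_J1 M_order J0_reps J1_reps h1.
  rewrite mem_Ru_dualH ?dft_Ru_sub //.
  by under eq_forallb do rewrite dotH_dft_I1 //.
have -> : h \in J2 by move: hJ; rewrite !inE h0 h1.
rewrite (ord_oppK h) (card_cyc_coset_opp M_order) mem_Ru_dualE //.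
exact: dft_Ru_sub.
Qed.

Lemma dual_component_sub h : h \in J -> D' h \subset Ru_sub p a (GR (deg h)).
Proof.
move=> hJ; apply/subsetP=> x; rewrite /D'.
have sub S I : x \in Ru_dualE S I -> x \in Ru_sub p a S.
  by rewrite !inE => /andP[].
do 2?[case: ifP => _]; first exact: sub; last first.
  by move/sub; rewrite (card_cyc_coset_opp M_order).
by rewrite !inE => /andP[].
Qed.

Variable C : {set 'rV[G]_n}.
Hypothesis C_cyclic : cyclic_code (GR s) C.
Hypothesis CD : corresponds m' zeta J C D.

Let C_words : {subset C <= words n (GR s)}.
Proof. by case: C_cyclic => /subsetP. Qed.

Let C_shift : {in C, forall v, cshift v \in C}.
Proof. by case: C_cyclic. Qed.

Let C0 : 0 \in C. Proof. by case: C_cyclic. Qed.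

Lemma corresponds_dft (E : 'I_m -> {set Ru G p a}) c h :
  corresponds m' zeta J C E -> c \in C -> h \in J -> dft c h \in E h.
Proof.
move=> CE cC hJ; have : dft_on m' zeta J c \in dft_on m' zeta J @: C.
  exact: imset_f.
by rewrite CE inE => /forallP/(_ (exist _ h hJ)); rewrite ffunE.
Qed.

(** The zero word fills the other coordinates, so a product of components determines each of its
    factors. *)
Lemma mem_corresponds (E : 'I_m -> {set Ru G p a}) h x :
  corresponds m' zeta J C E -> h \in J ->
  (x \in E h) = ([ffun g : {g | g \in J} =>
    if val g == h then x else dft 0 (val g)] \in dft_on m' zeta J @: C).
Proof.
move=> CE hJ; rewrite CE inE.
apply/idP/forallP=> [xE g|/(_ (exist _ h hJ))]; last by rewrite ffunE eqxx.
rewrite ffunE; case: eqP => [->//|_].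
exact: corresponds_dft CE C0 (valP g).
Qed.

Lemma corresponds_lift h x : h \in J -> x \in D h ->
  exists2 c, c \in C & dft c h = x.
Proof.
move=> hJ; rewrite (mem_corresponds _ CD hJ) => /imsetP[c cC].
move/ffunP/(_ (exist _ h hJ)).
by rewrite !ffunE eqxx => ->; exists c.
Qed.

Lemma corresponds_dual : corresponds m' zeta J (dualE (GR s) C) D'.
Proof.
apply/setP=> y; rewrite [RHS]inE; apply/imsetP/forallP.
  case=> d; rewrite inE => /andP[dS /forall_inP dC] -> [h hJ].
  rewrite ffunE mem_dual_component //; apply/forall_inP=> x xD.
  have [c cC <-] := corresponds_lift (star_reps hJ) xD; apply/eqP.
  apply: (dft_orthogonal p_prime m'_inv zeta_m C_shift cC).
    by move=> v vC; apply/eqP/dC.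
  by rewrite addnC /dvdn (ord_oppE (star h)) mod0n.
(* Conversely, y is the transform of some word d; Parseval reduces the orthogonality of d to C to
   that of the components. *)
move=> yD'; have [h|d dS dy] := @dft_on_surj y.
  exact: (subsetP (dual_component_sub (valP h))).
exists d; rewrite // inE dS; apply/forall_inP=> c cC.
have cS := C_words cC.
have : dotE c d *+ m = 0.
  rewrite -(parseval_dft p_prime m_gt0 m'_inv zeta_m pNm zeta_prim unit_sub1).
  rewrite big1 // => g _.
  have [h hJ [k ->]] := reps_cover M_order J0_reps J1_reps J2_reps g.
  apply: dotE_dft_iter => //.
  (* The condition at [star h] concerns D at [star (star h)], which is h. *)
  have := yD' (exist (fun g => g \in J) _ (star_reps hJ)).
  rewrite -dy ffunE mem_dual_component ?star_reps // starK => /forall_inP dh.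
  by apply/eqP/dh/(corresponds_dft CD).
have [w wm] := unit_m; rewrite -mulr_natl => /(congr1 ( *%R w)).
by rewrite mulrA wm mul1r mulr0 => ->.
Qed.

Lemma self_dual_components :
  C = dualE (GR s) C <-> forall h, h \in J -> D h = D' h.
Proof.
have CD' := corresponds_dual.
split=> [CC h hJ|DD'].
  have CD'' : corresponds m' zeta J C D' by rewrite {1}CC.
  apply/setP=> x.
  by rewrite (mem_corresponds _ CD hJ) (mem_corresponds _ CD'' hJ).
have imC : dft_on m' zeta J @: C = dft_on m' zeta J @: dualE (GR s) C.
  rewrite CD CD'; apply/setP=> y; rewrite !inE.
  by apply: eq_forallb => h; rewrite (DD' _ (valP h)).
apply/setP=> c; apply/idP/idP=> cC.
  have /imsetP[d dC cd] :
      dft_on m' zeta J c \in dft_on m' zeta J @: dualE (GR s) C.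
    by rewrite -imC imset_f.
  rewrite (dft_on_inj _ _ cd) //; first exact: C_words.
  by move: dC; rewrite inE => /andP[].
have /imsetP[d dC cd] : dft_on m' zeta J c \in dft_on m' zeta J @: C.
  by rewrite imC imset_f.
rewrite (dft_on_inj _ _ cd) //; last exact: C_words.
by move: cC; rewrite inE => /andP[].
Qed.

End Representatives.

End SelfDuality.

Theorem proposition4p6 (p s a m M : nat)
    (p_prime : prime p) (s_gt0 : (0 < s)%N) (m_gt0 : (0 < m)%N)
    (pNm : ~~ (p %| m)%N) (M_order : is_mult_order m (p ^ s) M)
    (G : finComNzRingType) (GR : nat -> {set G})
    (GR_G : GR_tower p (s * M) GR)
    (zeta : G) (zeta_prim : m.-primitive_root zeta)
    (m' : int) (m'_inv : (m%:Z * m' = 1 %[mod (p ^ a)%:Z])%Z)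
    (J0 J1 J2 : {set 'I_m})
    (J0_reps : coset_reps (p ^ s) J0 (I0 m))
    (J1_reps : coset_reps (p ^ s) J1 (I1 m (p ^ s)))
    (J2_reps : coset_reps (p ^ s) J2 (I2 m (p ^ s)))
    (J2_opp : forall h : 'I_m, (h \in J2) = (ord_opp h \in J2))
    (C : {set 'rV[G]_(m * p ^ a)}) (C_cyclic : cyclic_code (GR s) C)
    (D : 'I_m -> {set Ru G p a}) :
  let J := J0 :|: J1 :|: J2 in
  let deg (h : 'I_m) := (s * #|cyc_coset (p ^ s) h|)%N in
  (forall h, h \in J -> Ru_ideal (GR (deg h)) (D h)) ->
  corresponds m' zeta J C D ->
  corresponds m' zeta J (dualE (GR s) C)
    (fun h =>
       if h \in J0 then Ru_dualE (GR (deg h)) (D h)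
       else if h \in J1 then Ru_dualH (deg h) (GR (deg h)) (D h)
       else Ru_dualE (GR (deg (ord_opp h))) (D (ord_opp h)))
  /\
  (C = dualE (GR s) C <->
   [/\ forall j, j \in J0 -> D j = Ru_dualE (GR (deg j)) (D j),
       forall h, h \in J1 -> D h = Ru_dualH (deg h) (GR (deg h)) (D h)
     & forall k, k \in J2 ->
         D k = Ru_dualE (GR (deg (ord_opp k))) (D (ord_opp k))]).
Proof.
move=> J deg _ CD.
have [M_gt0 qM _] := M_order.
have R_gt0 : (0 < s * M)%N by rewrite muln_gt0 s_gt0.
have [sigma [GR_fixed GR_conjE sigma_root unit_sub1 unit_m]] :=
  GR_tower_Frobenius p_prime R_gt0 GR_G.
have [phi phiE] := iter_rmorphism sigma s.
have GR_card r : (r %| s * M)%N -> #|GR r| = (p ^ (2 * r))%N.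
  by move=> rR; apply: card_is_GR => //; case: GR_G => _; apply.
have zeta_m := prim_expr_order zeta_prim.
have sigma_zeta : sigma zeta = zeta ^+ p.
  (* zeta is fixed by the power p^(s M), because (p^s)^M = 1 modulo m; hence zeta is a Teichmuller
     element. *)
  apply: sigma_root; rewrite -(expr_mod _ zeta_m) expnM qM.
  by rewrite (expr_mod _ zeta_m) expr1.
have phi_zeta : phi zeta = zeta ^+ (p ^ s).
  rewrite phiE; elim: (s) => [|k IHk]; first by rewrite expr1.
  by rewrite iterS IHk rmorphXn sigma_zeta -exprM -expnS.
have unit1 (z : G) : z ^+ m = 1 -> z != 1 -> exists w, w * (z - 1) = 1.
  exact: unit_sub1 pNm.
split.
  exact: (corresponds_dual p_prime s_gt0 m_gt0 pNm M_order zeta_prim m'_inv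
    GR_card GR_fixed GR_conjE phiE phi_zeta unit1 (unit_m _ pNm)
    J0_reps J1_reps J2_reps J2_opp C_cyclic CD).
rewrite (self_dual_components p_prime s_gt0 m_gt0 pNm M_order zeta_prim m'_inv
  GR_card GR_fixed GR_conjE phiE phi_zeta unit1 (unit_m _ pNm)
  J0_reps J1_reps J2_reps J2_opp C_cyclic CD).
split=> [DD'|[D0 D1 D2] h hJ].
  split=> h hJk.
  - by have := DD' h; rewrite !inE hJk => /(_ isT).
  - have /andP[_ /negPf h0] := reps_J1 M_order J0_reps J1_reps hJk.
    by have := DD' h; rewrite !inE h0 hJk => /(_ isT).
  - have /andP[/negPf h0 /negPf h1] := reps_J2 J0_reps J1_reps J2_reps hJk.
    by have := DD' h; rewrite !inE h0 h1 hJk => /(_ isT).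
case: ifP => h0; first exact: D0.
case: ifP => h1; first exact: D1.
by apply: D2; move: hJ; rewrite !inE h0 h1.
Qed.
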